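(* Let $\mathbb{F}$ be a field, $d$ a positive integer, and let $(\mathcal J,\mathcal L)$ be a joints configuration in $\mathbb{F}^d$. Let $M\geq d$ be a real number with $|\mathcal J|=\binom{M}{d}$ and $|\mathcal L|=\binom{M}{d-1}$. Then $M$ is an integer, and there exist $M$ hyperplanes in $\mathbb{F}^d$ in general position such that $\mathcal J$ is the set of $d$-wise intersections of these hyperplanes and $\mathcal L$ is the set of $(d-1)$-wise intersections of these hyperplanes.
   Context: A point $p\in\mathbb{F}^d$ is a joint of a set of lines $\mathcal L$ if $p$ lies on $d$ lines of $\mathcal L$ whose directions are linearly independent. A joints configuration $(\mathcal J,\mathcal L)$ consists of a finite set $\mathcal L$ of lines in $\mathbb{F}^d$ and a finite set $\mathcal J$ of points each of which is a joint of $\mathcal L$. Hyperplanes are in general position if all their $d$-wise intersections are (single) points and these points are pairwise distinct. For real $x$, $\binom{x}{k}=x(x-1)\cdots(x-k+1)/k!$. *)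

(* Defs.v *)
From HB Require Import structures.
From mathcomp Require Import all_boot all_order all_algebra finmap.
From mathcomp Require Import boolp classical_sets reals.

Set Implicit Arguments.
Unset Strict Implicit.
Unset Printing Implicit Defensive.

Import Order.TTheory GRing.Theory Num.Theory.

Local Open Scope classical_set_scope.
Local Open Scope ring_scope.

Definition rbinom (R : realType) (x : R) (k : nat) : R :=
  (\prod_(i < k) (x - i%:R)) / k`!%:R.

Section Joints.
Variables (F : fieldType) (d : nat).
Implicit Types (p v : 'rV[F]_d) (l A : set 'rV[F]_d).

Definition line p v : set 'rV[F]_d := [set p + t *: v | t in [set: F]].

Definition is_direction l v : Prop := v != 0 /\ exists p, l = line p v.

Definition is_line l : Prop := exists v, is_direction l v.

(* The lines are automatically distinct, their directions being independent. *)
Definition is_joint (L : {fset set 'rV[F]_d}) p : Prop :=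
  exists (l : 'I_d -> set 'rV[F]_d) (v : 'I_d -> 'rV[F]_d),
    [/\ forall i, l i \in L /\ l i p,
        forall i, is_direction (l i) (v i)
      & free [tuple v i | i < d]].

Definition joints_configuration
    (J : {fset 'rV[F]_d}) (L : {fset set 'rV[F]_d}) : Prop :=
  (forall l, l \in L -> is_line l) /\ (forall p, p \in J -> is_joint L p).

Definition is_hyperplane A : Prop :=
  exists (a : 'cV[F]_d) (c : F), a != 0 /\ A = [set x | (x *m a) 0 0 = c].

(* For S = finset.set0 this is the whole space: when d = 1, the unique
   (d-1)-wise intersection is the line F^1 itself. *)
Definition inter m (H : 'I_m -> set 'rV[F]_d) (S : {set 'I_m}) :
  set 'rV[F]_d := \bigcap_(i in [set` S]) H i.

Definition wise_inter m (H : 'I_m -> set 'rV[F]_d) (k : nat) :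
  set (set 'rV[F]_d) := [set inter H S | S in [set S : {set 'I_m} | #|S| = k]].

Definition general_position m (H : 'I_m -> set 'rV[F]_d) : Prop :=
  (forall S : {set 'I_m}, #|S| = d -> exists p, inter H S = [set p]) /\
  (forall S T : {set 'I_m}, #|S| = d -> #|T| = d ->
     inter H S = inter H T -> S = T).

End Joints.

(* Main.v *)
Require Import Defs.
From HB Require Import structures.
From mathcomp Require Import all_boot all_order all_algebra finmap.
From mathcomp Require Import boolp classical_sets reals exp.
From mathcomp Require Import mpoly.
From mathcomp Require Import ring lra zify.

Set Implicit Arguments.
Unset Strict Implicit.
Unset Printing Implicit Defensive.

Import Order.TTheory GRing.Theory Num.Theory.

Local Open Scope ring_scope.

(** Choose at every joint [d] of its lines with independent directions; a flag is
a joint [p] with one of its chosen lines, [m] the number of flags on a line, and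
[x = M - d + 1].

Given integers [al p], let [f] be a nonzero polynomial of degree at most [n] and
[p] a joint minimizing [ord_p f - al p].  Counting zeros of the coefficients of the
expansion of [f] transversal to a line shows that every monomial [X^g] of the lowest
form of [f] at [p], in the coordinates of the lines through [p], satisfies
[|g| - g_i + sum_q max (0, g_i + al q - al p) <= n] for each [i], where [q] runs
over the joints of the [i]-th line.  So [binom (n + d) d] is at most the number of
such pairs [(p, g)].  Weighting degree [n] by [z^n], [0 < z < 1], the vector [al]
can be chosen such that all joints carry nearly the same weight.  The product of
the weights over all joints is then bounded by Hoelder's inequality, in which [al]
cancels along each line; letting [z] tend to 1 gives
[prod_flags binom (m + d - 1) d <= #J^(d #J)].  As [sum_flags 1 / m <= #L], the
values of [#J] and [#L] are the extremal ones, and they force [m = x] on every line.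

The same estimate with [al = 0] shows that the only polynomial of degree less than
[x] vanishing on all joints is 0, and so is the only polynomial of degree at most
[x] vanishing on all lines.  Hence there are Lagrange polynomials [f_p] of degree
[x - 1].  Let [h_(p,l)] be the affine form vanishing on the chosen lines through
[p] other than [l].  For [p], [q] on [l] the polynomials [h_(p,l) f_p] and
[h_(q,l) f_q] are proportional, so that [f_p] is the product of the [h_(q,l)],
[q <> p], for every line [l] through [p].  The [d] forms at [p] and the [x - 1]
factors of [f_p] are the [M] hyperplanes: moving from [p] to a neighbour [q] on [l]
exchanges [h_(p,l)] for [h_(q,l)], so that all [d]-subsets of the [M] hyperplanes
are met. *)

(** * Orders of vanishing *)

Section Frame.
Variables (F : fieldType) (d : nat).
Implicit Types (p q v : 'rV[F]_d) (A B : 'M[F]_d) (f g : {mpoly F[d]}).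

Lemma mpoly_rmorph_ext (S : comNzRingType) (g h : {rmorphism {mpoly F[d]} -> S}) :
  (forall c, g c%:MP = h c%:MP) -> (forall i, g 'X_i = h 'X_i) -> g =1 h.
Proof.
move=> gC gX f; rewrite (mpolyE f) !rmorph_sum; apply: eq_bigr => m _ /=.
rewrite -mul_mpolyC !rmorphM gC; congr (_ * _).
rewrite mpolyXE_id !rmorph_prod; apply: eq_bigr => i _.
by rewrite !rmorphXn /= gX.
Qed.

(** The substitution [X -> p + X A]: the coefficients of [frame p A f] are those of the expansion of
    [f] at [p] along the rows of [A]. *)
Definition frame p A : {mpoly F[d]} -> {mpoly F[d]} :=
  comp_mpoly [tuple (p 0 j)%:MP + \sum_k A k j *: 'X_k | j < d].
HB.instance Definition _ p A := GRing.RMorphism.copy (frame p A) (frame p A).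
HB.instance Definition _ p A := GRing.Linear.copy (frame p A) (frame p A).

Lemma frameC p A c : frame p A c%:MP = c%:MP.
Proof. exact: comp_mpolyC. Qed.

Lemma frameX p A j : frame p A 'X_j = (p 0 j)%:MP + \sum_k A k j *: 'X_k.
Proof. by rewrite /frame comp_mpolyXU -tnth_nth tnth_mktuple. Qed.

Lemma frame_comp p A q B f :
  frame q B (frame p A f) = frame (p + q *m A) (B *m A) f.
Proof.
apply: (mpoly_rmorph_ext (g := frame q B \o frame p A)) => [c|j] /=.
  by rewrite !frameC.
rewrite !frameX raddfD /= frameC raddf_sum /= !mxE mpolyCD -addrA; congr (_ + _).
under eq_bigr do rewrite linearZ /= frameX scalerDr.
rewrite big_split /= raddf_sum /=; congr (_ + _).
  by apply: eq_bigr => k _; rewrite -mul_mpolyC -mpolyCM mulrC.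
under eq_bigr do rewrite scaler_sumr.
rewrite exchange_big /=; apply: eq_bigr => k _.
by rewrite mxE scaler_suml; apply: eq_bigr => l _; rewrite scalerA mulrC.
Qed.

Lemma frame_id f : frame 0 1%:M f = f.
Proof.
apply: (mpoly_rmorph_ext (h := idfun)) => [c|j] /=; first by rewrite frameC.
rewrite frameX mxE add0r (bigD1 j) //= big1 ?mxE ?eqxx ?scale1r ?addr0 //.
by move=> k /negPf kj; rewrite mxE kj scale0r.
Qed.

Lemma frame_eq0 p A f : A \in unitmx -> (frame p A f == 0) = (f == 0).
Proof.
move=> Au; apply/eqP/eqP => [f0|->]; last exact: raddf0.
rewrite -(frame_id f).
have -> : frame 0 1%:M f = frame (- p *m invmx A) (invmx A) (frame p A f).
  by rewrite frame_comp mulmxKV // mulVmx // subrr.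
by rewrite f0 raddf0.
Qed.

Lemma msize_frame p A f : (msize (frame p A f) <= msize f)%N.
Proof.
rewrite /frame comp_mpolyEX; apply: (leq_trans (msize_sum _ _ _)).
apply/bigmax_leqP_seq => m mf _; apply: (leq_trans (msizeZ_le _ _)).
apply: leq_trans (msize_mdeg_lt mf); rewrite comp_mpolyX mdegE.
have sz1 j : (msize ((p 0%R j)%:MP_[d] + \sum_k A k j *: 'X_k) <= 2)%N.
  apply: (leq_trans (msizeD_le _ _)); rewrite geq_max msizeC.
  apply/andP; split; first by case: (_ != 0).
  apply: (leq_trans (msize_sum _ _ _)); apply/bigmax_leqP => k _.
  by apply: (leq_trans (msizeZ_le _ _)); rewrite msizeX mdeg1.
have szM (a b : {mpoly F[d]}) k l :
    (msize a <= k.+1 -> msize b <= l.+1 -> msize (a * b) <= (k + l).+1)%N.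
  move=> ak bl; have [->|a0] := eqVneq a 0; first by rewrite mul0r msize0.
  have [->|b0] := eqVneq b 0; first by rewrite mulr0 msize0.
  rewrite msizeM //; move: ak bl; move: (msize a) (msize b) => x y; lia.
have szX (a : {mpoly F[d]}) k : (msize a <= 2 -> msize (a ^+ k) <= k.+1)%N.
  move=> a2; elim: k => [|k IHk]; first by rewrite expr0 msize1.
  by rewrite exprS; apply: (szM _ _ 1 k).
elim/big_rec2: _ => [|j k g _ IH]; first by rewrite msize1.
by apply: szM => //; apply: szX; rewrite tnth_mktuple.
Qed.

(** A lower bound on the order of vanishing at the origin, so that the zero polynomial needs no
    convention. *)
Definition order_ge r f := all (fun m => (r <= mdeg m)%N) (msupp f).

Lemma order_geP r f :
  reflect (forall m, f@_m != 0 -> (r <= mdeg m)%N) (order_ge r f).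
Proof.
by apply: (iffP allP) => H m; move/(_ m): H; rewrite mcoeff_msupp.
Qed.

Lemma order_geD r f g : order_ge r f -> order_ge r g -> order_ge r (f + g).
Proof.
move=> /order_geP rf /order_geP rg; apply/order_geP => m; rewrite mcoeffD.
by have [->|/rf //] := eqVneq (f@_m) 0; rewrite add0r => /rg.
Qed.

Lemma order_ge0 r : order_ge r 0.
Proof. by apply/order_geP => m; rewrite mcoeff0 eqxx. Qed.

Lemma order_ge0n f : order_ge 0 f.
Proof. exact/allP. Qed.

Lemma order_geZ r c f : order_ge r f -> order_ge r (c *: f).
Proof.
move=> /order_geP rf; apply/order_geP => m; rewrite mcoeffZ.
by rewrite mulf_eq0 negb_or => /andP[_ /rf].
Qed.

Lemma order_geM r s f g : order_ge r f -> order_ge s g -> order_ge (r + s) (f * g).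
Proof.
move=> /allP rf /allP sg; apply/allP => m /msuppM_le /allpairsP[[m1 m2] /= [+ + ->]].
by move=> /rf r1 /sg s2; rewrite mdegD leq_add.
Qed.

Lemma order_geX r k f : order_ge r f -> order_ge (r * k) (f ^+ k).
Proof.
move=> rf; elim: k => [|k IH]; first by rewrite muln0 order_ge0n.
by rewrite exprS mulnS order_geM.
Qed.

Lemma order_ge_leq r s f : (s <= r)%N -> order_ge r f -> order_ge s f.
Proof. by move=> sr /allP rf; apply/allP => m /rf; apply: leq_trans. Qed.

(** A linear substitution replaces each variable by a form without constant term, so it cannot lower
    the order. *)
Lemma order_ge_linear r A f : order_ge r f -> order_ge r (frame 0 A f).
Proof.
move=> /allP rf; rewrite /frame comp_mpolyEX big_seq.
elim/big_ind: _ => [||m mf]; [exact: order_ge0|exact: order_geD|].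
apply: order_geZ; apply: order_ge_leq (rf _ mf) _.
rewrite comp_mpolyX mdegE; elim/big_rec2: _ => [|j k g _ IH].
  exact: order_ge0n.
apply: order_geM => //; rewrite -[X in order_ge X]mul1n; apply: order_geX.
rewrite tnth_mktuple mxE raddf0 add0r.
elim/big_ind: _ => [||k' _]; [exact: order_ge0|exact: order_geD|].
apply: order_geZ; apply/allP => m'; rewrite msuppX inE => /eqP ->.
by rewrite mdeg1.
Qed.

Definition strip (i : 'I_d) (m : 'X_{1..d}) : 'X_{1..d} := (m - U_(i) *+ m i)%MM.

Lemma strip_i i m : strip i m i = 0%N.
Proof. by rewrite mnmBE mulmnE mnm1E eqxx mul1n subnn. Qed.

Lemma strip_addK i m : (strip i m + U_(i) *+ m i)%MM = m.
Proof.
apply/mnmP => j; rewrite mnmDE mnmBE mulmnE mnm1E.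
by case: eqVneq => [->|_]; rewrite ?mul1n ?subnn ?mul0n ?subn0 ?addn0.
Qed.

Lemma strip_add i (m : 'X_{1..d}) k : m i = 0%N -> strip i (m + U_(i) *+ k)%MM = m.
Proof.
move=> mi; apply/mnmP => j; rewrite mnmBE !mnmDE !mulmnE !mnm1E eqxx mul1n mi add0n.
by case: eqVneq => [<-|_]; rewrite ?mi ?mul1n ?addnK ?mul0n ?subn0 ?addn0 ?subnn.
Qed.

Lemma mdeg_strip i m : mdeg (strip i m) = (mdeg m - m i)%N.
Proof. by rewrite -{2}(strip_addK i m) mdegD mdegMn mdeg1 mul1n addnK. Qed.

(* Regards the [i]-th variable as the variable of the coefficient ring. *)
Definition split_var (i : 'I_d) : {mpoly F[d]} -> {mpoly {poly F}[d]} :=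
  mmap (@mpolyC d {poly F} \o polyC) (fun j => if j == i then 'X%:MP else 'X_j).
HB.instance Definition _ i := GRing.RMorphism.copy (split_var i) (split_var i).

Lemma split_varC i c : split_var i c%:MP = c%:P%:MP.
Proof. by rewrite /split_var mmapC. Qed.

Lemma split_varX i j : split_var i 'X_j = if j == i then 'X%:MP else 'X_j.
Proof. by rewrite /split_var mmapX mmap1U. Qed.

Lemma split_var_mon i m : split_var i 'X_[m] = 'X^(m i) *: 'X_[strip i m].
Proof.
rewrite mpolyXE_id rmorph_prod /= (bigD1 i) //= rmorphXn /= split_varX eqxx.
rewrite -rmorphXn /= mul_mpolyC; congr (_ *: _).
rewrite [in RHS]mpolyXE_id [in RHS](bigD1 i) //= strip_i expr0 mul1r.
apply: eq_bigr => j /negPf ji; rewrite rmorphXn /= split_varX ji.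
by rewrite mnmBE mulmnE mnm1E eq_sym ji mul0n subn0.
Qed.

Lemma split_varE i f (m : 'X_{1..d}) k : m i = 0%N ->
  ((split_var i f)@_m)`_k = f@_(m + U_(i) *+ k).
Proof.
move=> mi; rewrite {1}(mpolyE f) rmorph_sum /= raddf_sum /= coef_sum.
set m' := (m + _)%MM.
have termE (u : 'X_{1..d}) :
    ((split_var i (f@_u *: 'X_[u]))@_m)`_k = f@_u * (u == m')%:R.
  rewrite -mul_mpolyC rmorphM /= split_varC split_var_mon mul_mpolyC !mcoeffZ mcoeffX.
  rewrite coefCM; congr (_ * _).
  have <- : (strip i u == m) && (k == u i) = (u == m').
    rewrite /m'; apply/andP/eqP => [[/eqP <- /eqP ->]|->]; first by rewrite strip_addK.
    by rewrite strip_add // eqxx mnmDE mulmnE mnm1E eqxx mi mul1n add0n eqxx.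
  by case: (strip i u == m); rewrite ?mulr1 ?mulr0 ?coefXn ?coef0.
rewrite (eq_bigr _ (fun u _ => termE u)) [in RHS](mpolyE f) raddf_sum /=.
by apply: eq_bigr => u _; rewrite mcoeffZ mcoeffX.
Qed.

(** Moving the centre along the [i]-th axis acts on each transversal coefficient separately, as a
    univariate shift. *)
Lemma split_var_shift i t f :
  split_var i (frame (t *: delta_mx 0 i) 1%:M f)
    = map_mpoly (comp_poly ('X + t%:P)) (split_var i f).
Proof.
apply: (mpoly_rmorph_ext (g := split_var i \o frame (t *: delta_mx 0 i) 1%:M)
  (h := map_mpoly (comp_poly ('X + t%:P)) \o split_var i)) => [c|j] /=.
  by rewrite frameC !split_varC map_mpolyC /= comp_polyC.
have -> : frame (t *: delta_mx 0 i) 1%:M 'X_j = (t *+ (j == i))%:MP + 'X_j.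
  rewrite frameX !mxE eqxx /= mulr_natr; congr (_ + _).
  rewrite (bigD1 j) //= big1 ?mxE ?eqxx ?scale1r ?addr0 //.
  by move=> k /negPf kj; rewrite mxE kj scale0r.
rewrite rmorphD /= split_varC split_varX.
case: eqVneq => [_|_].
  by rewrite map_mpolyC /= comp_polyX mpolyCD addrC.
by rewrite map_mpolyX mulr0n !mpolyC0 add0r.
Qed.

(** With [s] the transversal degree of [m], the coefficient [H] of [strip i m] in the transversal
    expansion is a nonzero univariate polynomial of degree at most [n - s] that vanishes at [t j] to
    order at least [r j - s]. Counting zeros gives the bound. *)
Lemma line_order i (I : finType) (B : {set I}) (t : I -> F) (r : I -> nat) f n
    (m : 'X_{1..d}) :
    (msize f <= n.+1)%N -> {in B &, injective t} ->
    (forall j, j \in B -> order_ge (r j) (frame (t j *: delta_mx 0 i) 1%:M f)) ->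
    m \in msupp f ->
  ((mdeg m - m i) + \sum_(j in B) (r j - (mdeg m - m i)) <= n)%N.
Proof.
move=> fn tI ord mf; set s := (mdeg m - m i)%N.
set H := (split_var i f)@_(strip i m).
have mE : mdeg m = (s + m i)%N.
  by rewrite /s subnK // mdegE (bigD1 i) //= leq_addr.
have H0 : H != 0.
  apply: contraTneq mf => H0.
  by rewrite -mcoeff_eq0 -(strip_addK i m) -split_varE ?strip_i // -/H H0 coef0.
have Hsz : (size H <= n.+1 - s)%N.
  apply/leq_sizeP => k kn; rewrite /H split_varE ?strip_i //.
  apply: memN_msupp_eq0; apply: msize_mdeg_ge; apply: (leq_trans fn).
  rewrite mdegD mdegMn mdeg1 mul1n mdeg_strip -/s; lia.
have Hdvd j : j \in B -> ('X - (t j)%:P) ^+ (r j - s) %| H.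
  (* The [k]-th coefficient of the shifted [H] is the coefficient in the recentred [f] of a monomial
     of degree [s + k < r j]. *)
  move=> jB; have ce k : (k < r j - s)%N -> (H \Po ('X + (t j)%:P))`_k = 0.
    move=> kr; rewrite /H -[_ \Po _]/(comp_poly ('X + (t j)%:P) _) -mcoeff_map_mpoly.
    rewrite -split_var_shift split_varE ?strip_i //.
    apply/eqP/negP => /negP; move/(order_geP _ _ (ord _ jB)).
    by rewrite mdegD mdegMn mdeg1 mul1n mdeg_strip -/s; lia.
  have : 'X^(r j - s) %| (H \Po ('X + (t j)%:P)).
    have t0 : take_poly (r j - s) (H \Po ('X + (t j)%:P)) = 0.
      by apply/polyP => k; rewrite coef_take_poly coef0; case: ifP => // /ce.
    by rewrite -(poly_take_drop (r j - s) (H \Po _)) t0 add0r dvdp_mull.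
  move=> /dvdpP[u Hu]; have <- : (H \Po ('X + (t j)%:P)) \Po ('X - (t j)%:P) = H.
    by rewrite -comp_polyA comp_polyD comp_polyX comp_polyC subrK comp_polyXr.
  by rewrite Hu comp_polyM comp_Xn_poly dvdp_mull.
have : \prod_(j in B) ('X - (t j)%:P) ^+ (r j - s) %| H.
  rewrite -big_enum /=; have : {subset enum B <= B} by move=> j; rewrite mem_enum.
  have := enum_uniq B; elim: (enum B) => [|j l IHl] /=; first by rewrite big_nil dvd1p.
  move=> /andP[jl ul] sub; rewrite big_cons.
  rewrite Gauss_dvdp ?Hdvd ?IHl ?sub ?mem_head //.
    by move=> x xl; rewrite sub ?inE ?xl ?orbT.
  rewrite big_seq; elim/big_ind: _ => [|x y cx cy|j' j'l]; first exact: coprimep1.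
    by rewrite coprimepMr cx cy.
  apply/coprimep_expl/coprimep_expr; rewrite coprimep_XsubC2 // subr_eq0.
  apply: contraNneq jl => tE.
  by rewrite (tI j j') // sub ?inE ?eqxx ?j'l ?orbT.
move=> /(dvdp_leq H0); rewrite size_prod; last first.
  by move=> j _; rewrite expf_neq0 ?polyXsubC_eq0.
have szE j : size (('X - (t j)%:P) ^+ (r j - s)) = (r j - s).+1 by rewrite size_exp_XsubC.
under eq_bigr do rewrite szE -addn1.
have sn : (s <= n)%N.
  rewrite -ltnS; apply: leq_trans fn.
  by apply: leq_ltn_trans (msize_mdeg_lt mf); rewrite leq_subr.
rewrite big_split /= sum1_card -addSn addnK => Hle.
move: (leq_trans Hle Hsz) sn; move: (\sum_(j in B) _)%N => x; lia.
Qed.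

End Frame.

(** * Monomials of lowest degree and parameter counting *)

Section Core.
Variables (F : fieldType) (d : nat) (P : finType) (pt : P -> 'rV[F]_d).
Variables (A : P -> 'M[F]_d) (inc : P -> 'I_d -> pred P).
Hypothesis pt_inj : injective pt.
Hypothesis A_unit : forall p, A p \in unitmx.
Hypothesis incP : forall p i q, inc p i q ->
  exists t, pt q = pt p + t *: row i (A p).

(* The point [p] minimizes [ord_p f - al p], and [m] is a monomial of lowest
   degree of [f] at [p]. *)
Lemma exists_low_monomial (B : {set P}) (al : P -> nat) (f : {mpoly F[d]}) n :
    B != finset.set0 -> f != 0 -> (msize f <= n.+1)%N ->
  exists p m, [/\ p \in B, (frame (pt p) (A p) f)@_m != 0
    & forall i, (mdeg m - m i + \sum_(q in B | inc p i q) (m i + al q - al p) <= n)%N].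
Proof.
move=> /set0Pn[p0 p0B] f0 fn; pose g p := frame (pt p) (A p) f.
have g0 p : g p != 0 by rewrite frame_eq0.
(* The monomial order is graded, so [o p] is the order of [f] at [p]. As [C] bounds every [al p],
   the truncated difference [C - al p] is a true one. *)
pose o p := mdeg (mlast (g p)); pose C := (\sum_p al p)%N.
have alC p : (al p <= C)%N by rewrite /C (bigD1 p) //= leq_addr.
have ordo p : order_ge (o p) (g p).
  by apply/allP => m mg; apply/lemc_mdeg/mlast_lemc.
have [p pB pmin] := arg_minnP (fun p => (o p + (C - al p))%N) p0B.
exists p, (mlast (g p)); split => // [|i]; first by rewrite -mcoeff_msupp mlast_supp.
set m := mlast (g p).
have /all_sig[t tP] q : {t | inc p i q ==> (pt q == pt p + t *: row i (A p))}.
  have [iq|_] := boolP (inc p i q); last by exists 0.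
  by apply: sigW; have [t ->] := incP iq; exists t; rewrite /= eqxx.
have ptE q : inc p i q -> pt q = pt p + t q *: row i (A p).
  by move=> iq; move/implyP: (tP q) => /(_ iq)/eqP.
have := @line_order F d i P [set q in B | inc p i q] t
  (fun q => mdeg m + al q - al p)%N (g p) n m.
rewrite (leq_trans (msize_frame _ _ _)) // mlast_supp // => /(_ isT).
set X := (X in ({in X &, _} -> _)) => H.
have {H} : (mdeg m - m i + \sum_(q in X) (mdeg m + al q - al p - (mdeg m - m i)) <= n)%N.
  apply: H => // [q q'|q].
    rewrite !inE => /andP[_ iq] /andP[_ iq'] tE; apply: pt_inj.
    by rewrite (ptE q) // (ptE q') // tE.
  rewrite inE => /andP[qB iq].
  (* For [q] on the line, recentring at [q] in the frame of [p] differs from the frame of [q] by a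
     linear substitution only, which keeps the order. *)
  have -> : frame (t q *: delta_mx 0 i) 1%:M (g p)
      = frame 0 (A p *m invmx (A q)) (g q).
    rewrite /g (frame_comp (pt p)) (frame_comp (pt q)) mul1mx mul0mx addr0.
    by rewrite -mulmxA mulVmx // mulmx1 (ptE q) // rowE scalemxAl.
  apply: order_ge_linear; apply: order_ge_leq (ordo q).
  have := pmin q qB; rewrite -/m -/(o p) -/(o q).
  have := alC p; have := alC q; rewrite /o -/m; lia.
apply: leq_trans; rewrite leq_add2l.
rewrite (eq_bigl _ _ (finset.in_set _)); apply: leq_sum => q _.
have : (m i <= mdeg m)%N by rewrite mdegE (bigD1 i) //= leq_addr.
lia.
Qed.

End Core.
Lemma exists_linear_relation (F : fieldType) (I K : finType) (c : I -> K -> F) :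
  (#|K| < #|I|)%N ->
  exists2 a : I -> F, (exists i, a i != 0) & forall k, \sum_i a i * c i k = 0.
Proof.
move=> KI; pose M := \matrix_(i < #|I|, k < #|K|) c (enum_val i) (enum_val k).
have /rowV0Pn[v vK v0] : kermx M != 0.
  rewrite -mxrank_eq0 mxrank_ker subn_eq0 -ltnNge.
  exact: leq_ltn_trans (rank_leq_col _) KI.
exists (fun i => v 0 (enum_rank i)).
  have [/existsP[j vj]|] := boolP [exists j, v 0 j != 0].
    by exists (enum_val j); rewrite enum_valK.
  rewrite negb_exists => /forallP v0j; case/eqP: v0; apply/rowP => j.
  by rewrite mxE; have := v0j j; rewrite negbK => /eqP.
move=> k; have /rowP/(_ (enum_rank k)) := sub_kermxP vK; rewrite !mxE => relk.
rewrite -[RHS]relk.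
rewrite (reindex (@enum_val I predT)) /=; last first.
  by apply: onW_bij; exact: enum_val_bij.
by apply: eq_bigr => i _; rewrite mxE enum_valK enum_rankK.
Qed.

Section LowSet.
Variables (d : nat) (P : finType) (inc : P -> 'I_d -> pred P).

(** The exponents allowed by [exists_low_monomial]. The cap [N] lets all degrees [n <= N] share one
    finite type. *)
Definition low_set (B : {set P}) (al : P -> nat) (n N : nat) (p : P) :
    {set {ffun 'I_d -> 'I_N.+1}} :=
  [set g : {ffun 'I_d -> 'I_N.+1} | [forall i : 'I_d, (\sum_j g j - g i +
     \sum_(q in B | inc p i q) (g i + al q - al p) <= n)%N]].

Variables (F : fieldType) (pt : P -> 'rV[F]_d) (A : P -> 'M[F]_d).
Hypothesis pt_inj : injective pt.
Hypothesis A_unit : forall p, A p \in unitmx.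
Hypothesis incP : forall p i q, inc p i q ->
  exists t, pt q = pt p + t *: row i (A p).

(** If the monomials of degree at most [n] outnumbered the pairs on the right, linear algebra would
    give a nonzero [f] of degree at most [n] whose coefficients at all these pairs vanish, against
    [exists_low_monomial]. *)
Lemma card_low_set (B : {set P}) (al : P -> nat) n N :
    (n <= N)%N -> B != finset.set0 ->
  (#|[set g : {ffun 'I_d -> 'I_N.+1} | (\sum_j g j <= n)%N]|
     <= \sum_(p in B) #|low_set B al n N p|)%N.
Proof.
move=> nN B0; rewrite leqNgt; apply/negP => lt.
pose G := {ffun 'I_d -> 'I_N.+1}.
pose I : finType := {g : G | (\sum_j g j <= n)%N}.
pose K : finType := {x : P * G | (x.1 \in B) && (x.2 \in low_set B al n N x.1)}.
pose mon (g : G) : 'X_{1..d} := [multinom (g j : nat) | j < d].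
have mon_inj : injective mon.
  move=> g h /mnmP gh; apply/ffunP => j; apply: val_inj.
  by have := gh j; rewrite !mnmE.
have mdegmon g : mdeg (mon g) = (\sum_j g j)%N.
  by rewrite mdegE; apply: eq_bigr => j _; rewrite mnmE.
have : (#|K| < #|I|)%N.
  rewrite !card_sig; move: lt; rewrite cardsE; apply: leq_trans.
  rewrite ltnS -sum1_card.
  rewrite -(pair_big_dep (mem B) (fun p g => g \in low_set B al n N p) (fun _ _ => 1%N)) /=.
  by apply: leq_sum => p _; rewrite sum1_card.
case/(exists_linear_relation
  (fun i k => (frame (pt (val k).1) (A (val k).1) 'X_[mon (val i)])@_(mon (val k).2))).
move=> a [i0 ai0] rel; pose f := \sum_i a i *: 'X_[mon (val i)] : {mpoly F[d]}.
have f0 : f != 0.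
  apply: contra_neq ai0 => f0; have := mcoeff0 F (mon (val i0)); rewrite -{1}f0.
  rewrite raddf_sum /= (bigD1 i0) //= mcoeffZ mcoeffX eqxx mulr1 big1 ?addr0 //.
  move=> i ii0; rewrite mcoeffZ mcoeffX [_ == _](_ : _ = false) ?mulr0 //.
  by apply: contraNF ii0 => /eqP/mon_inj/val_inj ->.
have fn : (msize f <= n.+1)%N.
  apply: (leq_trans (msize_sum _ _ _)); apply/bigmax_leqP => i _.
  by apply: (leq_trans (msizeZ_le _ _)); rewrite msizeX ltnS mdegmon (valP i).
have [p [m [pB cm lem]]] := exists_low_monomial pt_inj A_unit incP al B0 f0 fn.
have mn i : (m i <= n)%N.
  rewrite -ltnS; apply: leq_ltn_trans (_ : mdeg m < _)%N.
    by rewrite mdegE (bigD1 i) //= leq_addr.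
  apply: leq_trans fn; apply: leq_trans (msize_frame (pt p) (A p) f).
  by apply: msize_mdeg_lt; rewrite mcoeff_msupp.
pose g : G := [ffun j => inord (m j)].
have gE j : g j = m j :> nat by rewrite ffunE inordK // ltnS (leq_trans (mn j)).
have mong : mon g = m by apply/mnmP => j; rewrite mnmE gE.
have gK : ((p, g).1 \in B) && ((p, g).2 \in low_set B al n N (p, g).1).
  rewrite /= pB inE; apply/forallP => i; have := lem i.
  by rewrite -mong mdegmon mnmE.
have frE : frame (pt p) (A p) f = \sum_i a i *: frame (pt p) (A p) 'X_[mon (val i)].
  by rewrite linear_sum; apply: eq_bigr => i _; rewrite linearZ.
have relk := rel (Sub (p, g) gK); move: relk; rewrite /= mong => relk.
case/negP: cm; apply/eqP; rewrite frE raddf_sum /= -[RHS]relk.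
by apply: eq_bigr => i _; rewrite mcoeffZ.
Qed.

End LowSet.

(** * Weighted counting *)

Section SumShift.
Variable R : realType.

Lemma ler_sum_shift (f : nat -> R) (P : pred nat) m m' s :
    (forall n, 0 <= f n) ->
    (forall n, (n < m)%N -> P n -> (s <= n < m' + s)%N) ->
  \sum_(n < m | P n) f n <= \sum_(n < m' | P (n + s)%N) f (n + s)%N.
Proof.
move=> f0 Ps; pose k := (m + (m' + s))%N.
have -> : \sum_(n < m | P n) f n = \sum_(n < k | P n && (n < m)%N) f n.
  by rewrite (big_ord_widen_cond k) // leq_addr.
have -> : \sum_(n < m' | P (n + s)%N) f (n + s)%N
    = \sum_(n < k | P n && (s <= n < m' + s)%N) f n.
  rewrite -(big_mkord (fun n => P (n + s)%N) (fun n => f (n + s)%N)).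
  rewrite -{1}(addnK s m') -(big_addn 0 (m' + s) s P f) add0n.
  rewrite -(big_mkord (fun n => P n && (s <= n < m' + s)%N)).
  rewrite (big_nat_widen _ _ k) ?leq_addl // (big_nat_widenl _ 0) //.
  by apply: eq_bigl => n; rewrite -!andbA; congr (_ && _); rewrite andbC.
rewrite big_mkcond [leRHS]big_mkcond; apply: ler_sum => n _.
case: ifP => [/andP[Pn nm]|_]; first by rewrite Pn Ps.
by case: ifP => // _; rewrite f0.
Qed.

Lemma ler_sum_widen (f : nat -> R) (P : pred nat) m m' :
    (forall n, 0 <= f n) -> (forall n, (n < m)%N -> P n -> (n < m')%N) ->
  \sum_(n < m | P n) f n <= \sum_(n < m' | P n) f n.
Proof.
move=> f0 Pm; apply: le_trans (ler_sum_shift (m' := m') (s := 0) f0 _) _.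
  by move=> n nm Pn; rewrite addn0 Pm.
by rewrite le_eqVlt; apply/orP; left; apply/eqP; apply: eq_big => n; rewrite addn0.
Qed.

End SumShift.

(** * Sums of q-rising factorials *)

Section QSum.
Variables (R : realType) (z : R).
Hypotheses (z0 : 0 < z) (z1 : z < 1).

Let zX_ge0 k : 0 <= z ^+ k. Proof. by rewrite exprn_ge0 // ltW. Qed.
Let zX_le1 k : z ^+ k <= 1. Proof. by rewrite exprn_ile1 ?ltW. Qed.
Let zX_lt1 k : z ^+ k.+1 < 1. Proof. by rewrite exprn_ilt1 ?ltW. Qed.

Lemma geometric_sum (n : nat) : (1 - z) * \sum_(i < n) z ^+ i = 1 - z ^+ n.
Proof. by rewrite -opprB mulNr -subrX1 opprB. Qed.

(** The q-Pochhammer symbol [(z^(g+1); z)_n]. *)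
Definition qrising (n g : nat) : R := \prod_(k < n) (1 - z ^+ (g + k.+1)).

Lemma qrising_ge0 n g : 0 <= qrising n g.
Proof. by apply: prodr_ge0 => k _; rewrite subr_ge0. Qed.

Lemma qrisingS n g : qrising n.+1 g = qrising n g * (1 - z ^+ (g + n.+1)).
Proof. by rewrite /qrising big_ord_recr. Qed.

Lemma qrisingSl n g : qrising n.+1 g = (1 - z ^+ g.+1) * qrising n g.+1.
Proof.
rewrite /qrising big_ord_recl /= addn1; congr (_ * _).
by apply: eq_bigr => k _; rewrite /bump leq0n add1n addnS addSn.
Qed.

(* Summation by parts; a finite form of the q-beta integral. *)
Lemma qrising_sum_rec c n m :
  (1 - z ^+ c) * (\sum_(g < m) z ^+ (c * g) * qrising n.+1 g)
    + z ^+ (c * m) * (1 - z ^+ m) * qrising n m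
  = (1 - z ^+ n.+1) * \sum_(g < m) z ^+ (c.+1 * g) * qrising n g.
Proof.
elim: m => [|m IH]; first by rewrite !big_ord0 expr0 subrr !mulr0 mul0r addr0.
rewrite !big_ord_recr /= [in RHS]mulrDr -IH.
rewrite -[_ * (1 - z ^+ m.+1) * _]mulrA -qrisingSl qrisingS mulSn mulnS !exprD.
by ring.
Qed.

(** Dropping the nonnegative boundary term of [qrising_sum_rec] removes one factor of [qrising] and
    raises [c] by one. The bound is the value of the infinite sum. *)
Lemma qrising_sum_le c n m : (1 - z ^+ c.+1) * (\sum_(g < m) z ^+ (c.+1 * g) * qrising n g)
  <= \prod_(k < n) ((1 - z ^+ k.+1) / (1 - z ^+ (c.+1 + k.+1))).
Proof.
elim: n c m => [|n IH] c m.
  rewrite big_ord0; under eq_bigr do rewrite /qrising big_ord0 mulr1 exprM.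
  by rewrite -opprB mulNr -subrX1 opprB gerBl exprn_ge0.
have le1 : (1 - z ^+ c.+1) * (\sum_(g < m) z ^+ (c.+1 * g) * qrising n.+1 g)
    <= (1 - z ^+ n.+1) * \sum_(g < m) z ^+ (c.+2 * g) * qrising n g.
  rewrite -qrising_sum_rec lerDl !mulr_ge0 ?qrising_ge0 ?subr_ge0 //.
apply: (le_trans le1); have := IH c.+1 m; set S := \sum_(g < m) _ => IHm.
have p1 : 0 < 1 - z ^+ c.+2 by rewrite subr_gt0.
have -> : \prod_(k < n.+1) ((1 - z ^+ k.+1) / (1 - z ^+ (c.+1 + k.+1)))
    = (1 - z ^+ n.+1) * ((1 - z ^+ c.+2)^-1 *
       \prod_(k < n) ((1 - z ^+ k.+1) / (1 - z ^+ (c.+2 + k.+1)))).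
  rewrite !prodf_div big_ord_recr /= [X in _ / X]big_ord_recl /= addn1.
  under [X in _ / (_ * X)]eq_bigr do rewrite /bump leq0n add1n addnS -addSn.
  by rewrite invfM; ring.
apply: ler_wpM2l; first by rewrite subr_ge0.
by rewrite ler_pdivlMl.
Qed.

Lemma sum_blocks (f : nat -> R) c m :
  \sum_(t < m * c) f t = \sum_(g < m) \sum_(r < c) f (g * c + r)%N.
Proof.
elim: m => [|m IH]; first by rewrite !big_ord0.
by rewrite big_ord_recr /= -IH mulSnr big_split_ord.
Qed.

(** For [c > 0] the inner sum times [1 - z] is at most [1 - z^(t / c + 1)], so its [n]-th power is
    at most [qrising n (t / c)]; blocks of length [c] then lead to [qrising_sum_le]. The bound tends
    to [1 / binom (c + n) n] as [z] tends to 1. *)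
Lemma truncated_power_sum_le (n c N T : nat) :
  (1 - z) ^+ n.+1 *
    (\sum_(t < T) z ^+ t * (\sum_(g < N | (c * g <= t)%N) z ^+ g) ^+ n)
  <= \prod_(k < n) ((1 - z ^+ k.+1) / (1 - z ^+ (c + k.+1))).
Proof.
have z1' : 0 <= 1 - z by rewrite subr_ge0 ltW.
pose V t := (1 - z) * \sum_(g < N | (c * g <= t)%N) z ^+ g.
have V0 t : 0 <= V t by rewrite mulr_ge0 // sumr_ge0.
have VE : (1 - z) ^+ n.+1 *
      (\sum_(t < T) z ^+ t * (\sum_(g < N | (c * g <= t)%N) z ^+ g) ^+ n)
    = (1 - z) * \sum_(t < T) z ^+ t * V t ^+ n.
  rewrite exprS -mulrA mulr_sumr; congr (_ * _); apply: eq_bigr => t _.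
  by rewrite mulrCA -exprMn.
rewrite VE; have Vdef t : V t = (1 - z) * \sum_(g < N | (c * g <= t)%N) z ^+ g by [].
(* For [c = 0] the constraint on [g] is void and the right-hand side is 1, so geometric sums
   suffice. *)
clearbody V; case: c Vdef {VE} => [|c] Vdef.
  rewrite [leRHS]big1 => [|k _]; last by rewrite ?add0n divff // subr_eq0 gt_eqF.
  have V1 t : V t <= 1.
    rewrite Vdef (eq_bigl xpredT) => [|g]; last by rewrite mul0n.
    by rewrite geometric_sum gerBl.
  apply: (@le_trans _ _ ((1 - z) * \sum_(t < T) z ^+ t)).
    apply: ler_wpM2l => //; apply: ler_sum => t _.
    by rewrite ler_piMr // exprn_ile1.
  by rewrite geometric_sum gerBl.
have VU t : V t <= 1 - z ^+ (t %/ c.+1).+1.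
  rewrite Vdef -geometric_sum; apply: ler_wpM2l => //.
  apply: le_trans (ler_sum_widen (f := fun g => z ^+ g) (P := fun g => (c.+1 * g <= t)%N)
    (m' := (t %/ c.+1).+1) zX_ge0 _) _ => [g _ gt|].
    by rewrite ltnS leq_divRL // mulnC.
  rewrite big_mkcond; apply: ler_sum => g _.
  by case: ifP.
apply: le_trans (qrising_sum_le c n T).
have Vq t : V t ^+ n <= qrising n (t %/ c.+1).
  apply: (@le_trans _ _ ((1 - z ^+ (t %/ c.+1).+1) ^+ n)).
    by rewrite lerXn2r // nnegrE // subr_ge0.
  rewrite /qrising -[X in _ ^+ X](card_ord n) -prodr_const; apply: ler_prod => k _.
  rewrite subr_ge0 zX_le1 /= lerB //.
  by apply: ler_wiXn2l; rewrite ?ltW // addnS ltnS leq_addr.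
(* The range is extended to [T] whole blocks, on each of which [t %/ c.+1] is constant. *)
apply: (@le_trans _ _ ((1 - z) * \sum_(t < T * c.+1) z ^+ t * qrising n (t %/ c.+1))).
  apply: ler_wpM2l => //.
  apply: le_trans (ler_sum_widen (P := xpredT) (m' := (T * c.+1)%N)
    (fun t => mulr_ge0 (zX_ge0 t) (qrising_ge0 n (t %/ c.+1))) _).
    by apply: ler_sum => t _; apply: ler_wpM2l.
  by move=> t tT _; rewrite (leq_trans tT) // leq_pmulr.
rewrite (sum_blocks (fun t => z ^+ t * qrising n (t %/ c.+1))).
rewrite -[1 - z ^+ c.+1]geometric_sum -mulrA; apply: ler_wpM2l => //.
rewrite mulr_sumr le_eqVlt; apply/orP; left; apply/eqP; apply: eq_bigr => g _.
rewrite mulr_suml; apply: eq_bigr => r _.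
rewrite divnMDl // divn_small // addn0 exprD mulrAC mulrC mulrA mulrA.
by rewrite (mulnC g) [_ ^+ r * _]mulrC.
Qed.

End QSum.

(** * Real inequalities *)

Section Ineq.
Variable R : realType.

Lemma bernoulli_le (e : R) n : 0 <= e -> e <= 1 -> 1 - n%:R * e <= (1 - e) ^+ n.
Proof.
move=> e0 e1; elim: n => [|n IH]; first by rewrite mul0r subr0 expr0.
rewrite exprS; apply: (@le_trans _ _ ((1 - e) * (1 - n%:R * e))).
  rewrite -natr1; have : 0 <= n%:R * e * e by rewrite !mulr_ge0.
  by move=> ?; lra.
by apply: ler_wpM2l => //; rewrite subr_ge0.
Qed.

(** This replaces the passage to the limit [z -> 1]. *)
Lemma le_of_powers (a b : R) n :
  0 <= a -> (forall z, 0 < z -> z < 1 -> z ^+ n * a <= b) -> a <= b.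
Proof.
move=> a0 zab; rewrite leNgt; apply/negP => ba.
have b0 : 0 <= b.
  apply: le_trans (zab (2^-1) _ _); last 2 first.
  - by rewrite invr_gt0.
  - by rewrite invf_lt1 // ltr1n.
  by rewrite mulr_ge0 // exprn_ge0 // invr_ge0.
have a_gt0 : 0 < a := le_lt_trans b0 ba.
have n2 : (0 : R) < n%:R + 2 by rewrite ltr_wpDl.
(* Chosen such that [(1 - n e) a = b + 2 e a > b]; with Bernoulli's inequality this contradicts the
   hypothesis at [z = 1 - e]. *)
pose e := (a - b) / (a * (n%:R + 2)).
have eE : e * (a * (n%:R + 2)) = a - b.
  by rewrite /e divfK // mulf_neq0 ?gt_eqF.
have e0 : 0 < e by rewrite divr_gt0 ?subr_gt0 ?mulr_gt0.
have e1 : e < 1.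
  rewrite ltr_pdivrMr ?mulr_gt0 // mul1r mulrDr.
  have : 0 <= a * n%:R by rewrite mulr_ge0.
  lra.
have := zab (1 - e); rewrite subr_gt0 e1 gtrBl e0 => /(_ isT isT).
apply/negP; rewrite -ltNge.
apply: (@lt_le_trans _ _ ((1 - n%:R * e) * a)).
  have : 0 < e * a by rewrite mulr_gt0.
  have -> : (1 - n%:R * e) * a = a - (a - b) + e * a * 2 by rewrite -eE; ring.
  lra.
by apply: ler_wpM2r; rewrite ?bernoulli_le ?ltW.
Qed.

(* Weighted AM-GM, with weights normalized by the factors on the right. *)
Lemma holder_prod (I : finType) n (w : I -> R) (x : 'I_n -> I -> R) :
    (0 < n)%N -> (forall t, 0 <= w t) -> (forall i t, 0 <= x i t) ->
  (\sum_t w t * \prod_i x i t) ^+ n <= \prod_i \sum_t w t * x i t ^+ n.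
Proof.
move=> n0 w0 x0; pose S i := \sum_t w t * x i t ^+ n.
have wx0 i t : 0 <= w t * x i t ^+ n by rewrite mulr_ge0 // exprn_ge0.
have S0 i : 0 <= S i by apply: sumr_ge0.
(* The weights below divide by [S i]; if some [S i] is zero, the left-hand side vanishes. *)
have [/existsP[i /eqP Si0]|] := boolP [exists i, S i == 0].
  suff -> : \sum_t w t * \prod_i x i t = 0.
    by rewrite expr0n (gtn_eqF n0); apply: prodr_ge0 => j _; exact: S0.
  apply: big1 => t _.
  have : w t * x i t ^+ n = 0.
    apply/eqP; rewrite eq_le wx0 andbT -Si0 /S (bigD1 t) //= lerDl.
    exact: sumr_ge0.
  move/eqP; rewrite mulf_eq0 => /orP[/eqP->|]; first by rewrite mul0r.
  rewrite expf_eq0 n0 /= => /eqP xit.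
  by rewrite (bigD1 i) //= xit mul0r mulr0.
rewrite negb_exists => /forallP Sn0.
have Sgt0 i : 0 < S i by rewrite lt_def Sn0 S0.
have PS0 : 0 < \prod_i S i by apply: prodr_gt0.
pose r := (\prod_i S i) `^ n%:R^-1.
have r0 : 0 < r by rewrite powR_gt0.
have rE : r ^+ n = \prod_i S i.
  rewrite -powR_mulrn ?ltW // /r -powRrM mulVf ?powRr1 ?ltW //.
  by rewrite pnatr_eq0 -lt0n.
rewrite -rE lerXn2r ?nnegrE ?(ltW r0) //.
  by apply: sumr_ge0 => t _; rewrite mulr_ge0 // prodr_ge0.
have step t : w t * \prod_i x i t <= r * ((\sum_i w t * x i t ^+ n / S i) / n%:R).
  have mu0 : 0 <= (\sum_i w t * x i t ^+ n / S i) / n%:R.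
    rewrite divr_ge0 // sumr_ge0 // => i _; rewrite divr_ge0 //.
  rewrite -(ler_pXn2r n0) ?nnegrE; last 2 first.
  - by rewrite mulr_ge0 // prodr_ge0.
  - by rewrite mulr_ge0 // ltW.
  have [+ _] := @leif_AGM R 'I_n predT (fun i => w t * x i t ^+ n / S i)
    (fun i _ => divr_ge0 (wx0 i t) (S0 i)).
  rewrite card_ord => AG; rewrite [leRHS]exprMn rE -ler_pdivrMl // [leLHS]mulrC.
  apply: le_trans AG; rewrite prodf_div big_split /= prodr_const card_ord.
  by rewrite exprMn prodrXl.
apply: le_trans (ler_sum _ (fun t _ => step t)) _.
rewrite -mulr_sumr -mulr_suml exchange_big /=.
rewrite (eq_bigr (fun=> 1)) => [|i _]; last by rewrite -mulr_suml -/(S i) divff.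
by rewrite sumr_const card_ord divff ?mulr1 // pnatr_eq0 -lt0n.
Qed.

(** With [q k] the product over [e] of [(x + k) / (m e + k)], AM-GM gives [q k <= 1] for each [k],
    while the last hypothesis makes the product of the [q k] at least 1. So [q 0 = 1], and the
    equality case of AM-GM makes all [x / m e] equal to their mean 1. *)
Lemma eq_of_prod_rising_le (I : finType) n (m : I -> R) (x : R) :
    (0 < n)%N -> 0 < x -> (forall e, 0 < m e) -> \sum_e x / m e <= #|I|%:R ->
    \prod_e \prod_(k < n) (m e + k%:R) <= \prod_(e : I) \prod_(k < n) (x + k%:R) ->
  forall e, m e = x.
Proof.
move=> n0 x0 m0 summ prodm e0.
have I0 : (0 : R) < #|I|%:R by rewrite ltr0n; apply/card_gt0P; exists e0.
pose q k := \prod_e ((x + k%:R) / (m e + k%:R)).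
have mk e k : 0 < m e + k%:R by rewrite ltr_wpDr.
have xk k : 0 < x + k%:R by rewrite ltr_wpDr.
have sumle k : \sum_e (x + k%:R) / (m e + k%:R) <= #|I|%:R.
  (* As a function of [u = x / m e] the left-hand side is concave, and the right-hand side is its
     tangent at [u = 1]. *)
  have pt e : (x + k%:R) / (m e + k%:R) <= 1 + x / (x + k%:R) * (x / m e - 1).
    rewrite -subr_ge0.
    have -> : 1 + x / (x + k%:R) * (x / m e - 1) - (x + k%:R) / (m e + k%:R)
       = (m e - x) ^+ 2 * k%:R / (m e * (m e + k%:R) * (x + k%:R)).
      by field; rewrite !gt_eqF.
    apply: divr_ge0; first by rewrite mulr_ge0 ?sqr_ge0.
    by rewrite ltW // !mulr_gt0.
  apply: le_trans (ler_sum _ (fun e _ => pt e)) _.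
  rewrite big_split /= sumr_const -mulr_sumr big_split /= sumrN sumr_const.
  rewrite gerDl mulr_ge0_le0 ?subr_le0 // divr_ge0 ?ltW //.
have AG k := @leif_AGM R I predT (fun e => (x + k%:R) / (m e + k%:R))
  (fun e _ => divr_ge0 (ltW (xk k)) (ltW (mk e k))).
have mu1 k : (\sum_e (x + k%:R) / (m e + k%:R)) / #|I|%:R <= 1.
  by rewrite ler_pdivrMr // mul1r.
have mu0 k : 0 <= (\sum_e (x + k%:R) / (m e + k%:R)) / #|I|%:R.
  by rewrite divr_ge0 // sumr_ge0 // => e _; rewrite divr_ge0 ?ltW.
have q1 k : q k <= 1.
  by apply: le_trans (AG k).1 _; rewrite exprn_ile1.
have q0 k : 0 <= q k by apply: prodr_ge0 => e _; rewrite divr_ge0 ?ltW.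
have : 1 <= \prod_(k < n) q k.
  rewrite exchange_big /=.
  under eq_bigr do rewrite prodf_div.
  rewrite prodf_div ler_pdivlMr ?mul1r //.
  by apply: prodr_gt0 => e _; apply: prodr_gt0.
case: n n0 {prodm} => // n _; rewrite big_ord_recl /= => q_ge.
have q00 : 1 <= q 0.
  apply: (le_trans q_ge); rewrite ler_piMr //.
  by apply: prodr_ile1 => k; rewrite q0 q1.
have [AG1 AG2] := AG 0%N; set mu := (_ / _ : R) in AG1 AG2.
have mu_ge0 : 0 <= mu := mu0 0%N.
have mu_le1 : mu <= 1 := mu1 0%N.
have muE : mu ^+ #|I| = 1.
  apply/eqP; rewrite eq_le exprn_ile1 //=.
  by apply: le_trans q00 _; exact: AG1.
have mu_eq1 : mu = 1.
  by move/eqP: muE; rewrite pexpr_eq1 -?(ltr0n R) // => /eqP.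
have : \prod_(e in I) ((x + 0%:R) / (m e + 0%:R)) == mu ^+ #|I|.
  by rewrite eq_le AG1 muE; exact: q00.
rewrite AG2 => /forallP/(_ e0)/forallP all_eq.
have : mu = x / m e0.
  rewrite /mu (eq_bigr (fun=> x / m e0)) => [|e _].
    by rewrite sumr_const -[X in X / _]mulr_natr mulfK // gt_eqF.
  by have /eqP := all_eq e; rewrite !addr0.
by rewrite mu_eq1 => /(congr1 ( *%R^~ (m e0))); rewrite mul1r divfK // gt_eqF.
Qed.

End Ineq.

(** * Balancing the weights of the points *)

Section Balance.
Variables (R : realType) (d : nat) (P : finType) (inc : P -> 'I_d -> pred P).
Variables (z : R) (N : nat).
Hypothesis z0 : 0 < z.
Implicit Types (B : {set P}) (al : P -> nat) (p q : P).

(** A generating function in the degree, truncated at [N]; it merges the counts for all degrees into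
    one real number per point. *)
Definition weight B al p : R := \sum_(n < N.+1) #|low_set inc B al n N p|%:R * z ^+ n.

Definition total_weight : R :=
  \sum_(n < N.+1) #|[set g : {ffun 'I_d -> 'I_N.+1} | (\sum_j g j <= n)%N]|%:R * z ^+ n.

Definition raise al p : P -> nat := fun q => (al q + (q == p))%N.

Hypothesis card_low : forall B al n, (n <= N)%N -> B != finset.set0 ->
  (#|[set g : {ffun 'I_d -> 'I_N.+1} | (\sum_j g j <= n)%N]|
     <= \sum_(p in B) #|low_set inc B al n N p|)%N.

Lemma total_weight_le B al : B != finset.set0 ->
  total_weight <= \sum_(p in B) weight B al p.
Proof.
move=> B0; rewrite exchange_big /=; apply: ler_sum => n _.
rewrite -mulr_suml -natr_sum ler_wpM2r ?exprn_ge0 ?(ltW z0) //.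
by rewrite ler_nat card_low // -ltnS.
Qed.

(** As [g i <= N], a drop of more than [N] in [al] makes the terms of the points outside [B] zero by
    truncated subtraction. *)
Lemma weight_gap B al p :
    (forall q r, q \in B -> r \notin B -> (al r + N < al q)%N) ->
  p \in B -> weight B al p = weight [set: P] al p.
Proof.
move=> gap pB; apply: eq_bigr => n _; congr ((_)%:R * _); congr #|pred_of_set _|.
apply/setP => g; rewrite !inE; apply: eq_forallb => i.
congr ((_ + _ <= _)%N); rewrite [RHS](bigID (mem B)) /=.
rewrite [X in (_ + X)%N]big1 ?addn0; last first.
  move=> q /andP[_ qB]; apply/eqP; rewrite subn_eq0.
  apply: leq_trans (ltnW (gap _ _ pB qB)).
  by rewrite addnC leq_add2l -ltnS.
by apply: eq_bigl => q; rewrite inE /= andbC.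
Qed.

Lemma weight_raise al p q : p != q ->
  weight [set: P] (raise al q) p <= weight [set: P] al p.
Proof.
move=> pq; apply: ler_sum => n _; rewrite ler_wpM2r ?exprn_ge0 ?(ltW z0) //.
rewrite ler_nat; apply: subset_leq_card; apply/fintype.subsetP => g; rewrite !inE.
move=> /forallP gn; apply/forallP => i; apply: leq_trans (gn i); rewrite leq_add2l.
by apply: leq_sum => r _; rewrite /raise (negPf pq) addn0 leq_sub2r // leq_add2l leq_addr.
Qed.

(* [al] is a maximal vector such that no point raised above [0] has weight more
   than [T]; the entries are bounded, since the points above a gap in the values
   of [al] already carry the total weight. *)
Lemma exists_balanced (T : R) : 0 <= T -> #|P|%:R * T < total_weight ->
  exists al, forall p, T < weight [set: P] (raise al p) p.
Proof.
move=> T0 TD; pose S al := [forall p, (0 < al p)%N ==> (weight [set: P] al p <= T)].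
(* Superlevel sets at heights [k * N]. If two consecutive ones are equal and nonempty, they lie
   above a gap of more than [N], and [weight_gap] with [total_weight_le] bounds the total weight by
   [#|P| * T], against [TD]. *)
pose above al k := [set p | (k * N < al p)%N].
have above_lt al k : S al -> above al k != finset.set0 ->
    (#|above al k.+1| < #|above al k|)%N.
  move=> /forallP Sal ne; have sub : above al k.+1 \subset above al k.
    by apply/fintype.subsetP => p; rewrite !inE; apply: leq_ltn_trans; rewrite leq_mul.
  rewrite ltn_neqAle subset_leq_card // andbT; apply/negP => eqc.
  have eqB : above al k.+1 = above al k by apply/eqP; rewrite eqEcard sub /= (eqP eqc).
  move: TD; apply/negP; rewrite -leNgt.
  apply: le_trans (total_weight_le al ne) _.
  have -> : \sum_(p in above al k) weight (above al k) al p
     = \sum_(p in above al k) weight [set: P] al p.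
    apply: eq_bigr => p pB; apply: weight_gap => // q r.
    by rewrite -{1}eqB !inE -leqNgt mulSn; lia.
  apply: (@le_trans _ _ (\sum_(p in above al k) T)).
    by apply: ler_sum => p; rewrite inE => pk; apply: (implyP (Sal p)); lia.
  rewrite sumr_const -[leLHS]mulr_natl ler_wpM2r // ler_nat.
  exact: max_card.
have bounded al p : S al -> (al p <= #|P| * N)%N.
  move=> Sal; have card_le k : (#|above al k| <= #|P| - k)%N.
    elim: k => [|k IH]; first by rewrite subn0 max_card.
    have [E|ne] := eqVneq (above al k) finset.set0.
      suff -> : above al k.+1 = finset.set0 by rewrite cards0.
      apply/setP => q; move/setP/(_ q): E; rewrite !inE mulSn; lia.
    by have := above_lt _ _ Sal ne; lia.
  rewrite leqNgt; apply/negP => gt; have := card_le #|P|.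
  by rewrite subnn leqNgt => /negP; apply; apply/card_gt0P; exists p; rewrite inE.
pose ext (al : {ffun P -> 'I_(#|P| * N).+1}) : P -> nat := fun p => al p.
have S0 : S (ext [ffun=> ord0]) by apply/forallP => p; rewrite /ext ffunE.
have [al Sal almax] := @arg_maxnP _ [ffun=> ord0] (fun b => S (ext b))
  (fun b => \sum_p ext b p)%N S0.
exists (ext al) => p; rewrite ltNge; apply/negP => le.
(* Raising [p] only tightens the constraints at the other points, so the raised vector would satisfy
   [S] with a larger sum. *)
have Sr : S (raise (ext al) p).
  apply/forallP => q; apply/implyP; have [-> //|qp] := eqVneq q p.
  rewrite {1}/raise (negPf qp) addn0 => al0.
  exact: le_trans (weight_raise _ qp) (implyP (forallP Sal q) al0).
pose al' : {ffun P -> 'I_(#|P| * N).+1} := [ffun q => inord (raise (ext al) p q)].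
have al'E : ext al' = raise (ext al) p.
  by apply/funext => q; rewrite /ext ffunE inordK // ltnS bounded.
have := almax al'; rewrite /= al'E => /(_ Sr); rewrite leqNgt => /negP; apply.
rewrite /raise big_split /= -[X in (X < _)%N]addn0 ltn_add2l.
by rewrite (bigD1 p) //= eqxx.
Qed.

End Balance.

(** * The total weight and the bound for one flag *)

Section TotalWeight.
Variables (R : realType) (d : nat) (z : R).
Hypotheses (z0 : 0 < z) (z1 : z < 1).

Let zX_ge0 k : 0 <= z ^+ k. Proof. by rewrite exprn_ge0 // ltW. Qed.

Lemma exists_expr_lt (e : R) : 0 < e -> exists k, z ^+ k < e.
Proof.
move=> e0; have z1' : 0 < 1 - z by rewrite subr_gt0.
have [k kP] : exists k : nat, (1 - z)^-1 * e^-1 < k%:R.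
  exists (Num.bound ((1 - z)^-1 * e^-1)).
  by apply: archi_boundP; rewrite mulr_ge0 ?invr_ge0 ?ltW.
exists k; have k1 : 1 < k%:R * (1 - z) * e.
  have : (1 - z)^-1 * e^-1 * ((1 - z) * e) < k%:R * ((1 - z) * e).
    by rewrite ltr_pM2r ?mulr_gt0.
  have -> : (1 - z)^-1 * e^-1 * ((1 - z) * e) = 1 by field; rewrite !gt_eqF.
  by rewrite mulrA.
(* Bernoulli's inequality for [1 / z], in a form without division. *)
have key : (1 + k%:R * (1 - z)) * z ^+ k <= 1.
  elim: k {kP k1} => [|k IH]; first by rewrite mul0r addr0 mul1r.
  rewrite exprS; apply: le_trans IH; rewrite mulrA; apply: ler_wpM2r => //.
  have -> : (1 + k.+1%:R * (1 - z)) * z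
      = (1 + k%:R * (1 - z)) - (k%:R + 1) * (1 - z) ^+ 2 by rewrite -natr1; ring.
  by rewrite gerBl mulr_ge0 ?sqr_ge0 // addr_ge0.
rewrite ltNge; apply/negP => ez; move: key; apply/negP; rewrite -ltNge.
apply: lt_le_trans k1 _; apply: (@le_trans _ _ (k%:R * (1 - z) * z ^+ k)).
  by apply: ler_wpM2l => //; rewrite mulr_ge0 // ltW.
by apply: ler_wpM2r => //; rewrite lerDr.
Qed.

(** Only exponents [g] with entries at most [k] are kept. As [|g| <= d k], the degrees from [|g|] to
    [|g| + k] are all at most [(d + 1) k]; they give one geometric factor besides the [d] from
    [g]. *)
Lemma total_weight_ge k :
  ((1 - z ^+ k.+1) / (1 - z)) ^+ d.+1 <= total_weight d z (d.+1 * k)%N.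
Proof.
set N := (d.+1 * k)%N.
have -> : (1 - z ^+ k.+1) / (1 - z) = \sum_(i < k.+1) z ^+ i.
  by rewrite -geometric_sum mulrAC divff ?mul1r // subr_eq0 gt_eqF.
have -> : total_weight d z N = \sum_(g : {ffun 'I_d -> 'I_N.+1})
    \sum_(n < N.+1 | (\sum_j g j <= n)%N) z ^+ n.
  under [RHS]eq_bigr do rewrite big_mkcond.
  rewrite exchange_big /=; apply: eq_bigr => n _.
  rewrite -big_mkcond /= sumr_const mulr_natl; congr (_ *+ _).
  by apply: eq_card => g; rewrite inE.
have kN : (k <= N)%N by rewrite leq_pmull.
rewrite exprSr -[X in _ ^+ X]card_ord -prodr_const.
have -> : \prod_(i < d) \sum_(i < k.+1) z ^+ i
    = \prod_(i < d) \sum_(j < N.+1 | (j <= k)%N) z ^+ j.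
  by apply: eq_bigr => i _; rewrite (big_ord_widen N.+1) // ltnS.
rewrite bigA_distr_big mulr_suml [leRHS](bigID (mem (ffun_on (fun j : 'I_N.+1 => (j <= k)%N)))) /=.
rewrite -[leLHS]addr0; apply: lerD; last first.
  by apply: sumr_ge0 => g _; apply: sumr_ge0.
apply: ler_sum => g /ffun_onP gk; rewrite prodrXr; set s := (\sum_j g j)%N.
have sk : (s <= d * k)%N.
  by rewrite -[X in (X * _)%N]card_ord -sum_nat_const; apply: leq_sum => j _; apply: gk.
rewrite mulr_sumr.
have -> : \sum_(n < N.+1 | (s <= n)%N) z ^+ n = \sum_(j < N.+1 - s) z ^+ (j + s).
  rewrite -(big_mkord (fun n => s <= n)%N (fun n => z ^+ n)).
  rewrite -(big_mkord xpredT (fun j => z ^+ (j + s))) -(big_addn 0 N.+1 s xpredT (fun n => z ^+ n)).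
  by rewrite (big_nat_widenl s 0).
have kNs : (k.+1 <= N.+1 - s)%N by move: sk; rewrite /N mulSn; lia.
apply: le_trans (ler_sum_widen (m' := (N.+1 - s)%N) (P := xpredT) (f := fun j => z ^+ (j + s)) _ _) => //.
  by rewrite le_eqVlt; apply/orP; left; apply/eqP; apply: eq_bigr => j _; rewrite -exprD addnC.
by move=> n nk _; exact: leq_trans nk kNs.
Qed.

(** The untruncated total weight is [(1 - z)^-(d+1)], and a large [N] recovers more than the
    fraction [z] of it. *)
Lemma exists_total_weight_gt :
  exists N, z * ((1 - z)^-1) ^+ d.+1 < total_weight d z N.
Proof.
have z1' : 0 < 1 - z by rewrite subr_gt0.
have [k kP] : exists k, z ^+ k < (1 - z) / d.+1%:R.
  by apply: exists_expr_lt; rewrite divr_gt0.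
exists (d.+1 * k)%N; apply: lt_le_trans (total_weight_ge k).
rewrite exprMn ltr_pM2r ?exprn_gt0 ?invr_gt0 //.
have zk : z ^+ k.+1 < (1 - z) / d.+1%:R.
  by apply: le_lt_trans kP; rewrite exprS ler_piMl // ltW.
apply: lt_le_trans (bernoulli_le _ (zX_ge0 _) _).
  by move: zk; rewrite ltr_pdivlMr // [d.+1%:R * _]mulrC; lra.
by rewrite exprn_ile1 ?ltW.
Qed.

(** The factor [z ^+ a] turns the sum over [t] into one over [t + a]. Terms with [t + a < b] vanish,
    their inner sum being empty and [d > 0]; shifting by [b] leaves the sum of
    [truncated_power_sum_le]. *)
Lemma shifted_sum_le N (a b c : nat) : (0 < d)%N ->
  z ^+ a * (\sum_(t < N) z ^+ t * (\sum_(g < N | (c * g + b <= t + a)%N) z ^+ g) ^+ d)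
  <= z ^+ b * (((1 - z)^-1) ^+ d.+1 *
       \prod_(k < d) ((1 - z ^+ k.+1) / (1 - z ^+ (c + k.+1)))).
Proof.
move=> d0; pose f t := z ^+ t * (\sum_(g < N | (c * g + b <= t)%N) z ^+ g) ^+ d.
have f0 t : 0 <= f t by rewrite mulr_ge0 // exprn_ge0 // sumr_ge0.
have -> : z ^+ a * (\sum_(t < N) z ^+ t * (\sum_(g < N | (c * g + b <= t + a)%N) z ^+ g) ^+ d)
   = \sum_(t < N) f (t + a)%N.
  by rewrite mulr_sumr; apply: eq_bigr => t _; rewrite /f mulrA -exprD addnC.
apply: (@le_trans _ _ (\sum_(t < a + N | (b <= t)%N) f t)).
  have -> : \sum_(t < a + N | (b <= t)%N) f t = \sum_(t < a + N) f t.
    rewrite big_mkcond; apply: eq_bigr => t _; case: leqP => // tb.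
    rewrite /f [X in _ * X ^+ _]big1 ?expr0n ?gtn_eqF ?mulr0 //.
    by move=> g; rewrite leqNgt (leq_trans tb) // leq_addl.
  rewrite big_split_ord /= [leLHS](eq_bigr (fun t : 'I__ => f (a + t)%N)).
    by rewrite lerDr sumr_ge0.
  by move=> t _; rewrite addnC.
apply: le_trans (ler_sum_shift (m' := (a + N)%N) (s := b) f0 _) _.
  by move=> t tN bt; rewrite bt ltn_addr.
rewrite (eq_bigl xpredT) => [|t]; last by rewrite leq_addl.
have -> : \sum_(t < a + N) f (t + b)%N = z ^+ b *
    \sum_(t < a + N) z ^+ t * (\sum_(g < N | (c * g <= t)%N) z ^+ g) ^+ d.
  rewrite mulr_sumr; apply: eq_bigr => t _; rewrite /f mulrA -exprD addnC.
  by congr (_ * _ ^+ _); apply: eq_bigl => g; rewrite [(_ + b)%N]addnC leq_add2l.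
apply: ler_wpM2l => //; rewrite exprVn ler_pdivlMl ?exprn_gt0 ?subr_gt0 //.
exact: truncated_power_sum_le.
Qed.

End TotalWeight.

(** * Flags and multiplicities of lines *)

Section Flags.
Variables (d : nat) (P Lt : finType) (ell : P -> 'I_d -> Lt).
Hypothesis ell_inj : forall p, injective (ell p).

(** Incidence is relative to the chosen lines: the line has to be among those chosen at [q], not
    merely pass through it. *)
Definition incident (p : P) (i : 'I_d) : pred P :=
  [pred q | [exists j, ell q j == ell p i]].

Definition other_points (p : P) (i : 'I_d) : {set P} := [set q | incident p i q & q != p].

Definition multiplicity (l : Lt) : nat := #|[set e : P * 'I_d | ell e.1 e.2 == l]|.

Lemma sum_other_points (f : P -> nat) p i :
  (\sum_(q in other_points p i) f q = \sum_(q | q != p) \sum_(j | ell q j == ell p i) f q)%N.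
Proof.
rewrite [RHS](bigID (incident p i)) /= [X in (_ + X)%N]big1 ?addn0; last first.
  move=> q /andP[_ /existsP nq]; apply: big1 => j qj; case: nq; by exists j.
apply: eq_big => [q|q]; rewrite inE; first by rewrite andbC.
move=> /andP[/existsP[j /eqP qj] _].
rewrite (big_pred1 j) // => k; rewrite -qj /=.
by apply/eqP/eqP => [/ell_inj|->].
Qed.

Lemma card_other_points p i : (#|other_points p i|.+1 = multiplicity (ell p i))%N.
Proof.
rewrite -sum1_card sum_other_points /multiplicity -sum1_card.
rewrite (eq_bigl (fun e => predT e.1 && (ell e.1 e.2 == ell p i))) => [|e]; last by rewrite inE.
rewrite -(pair_big_dep predT (fun q j => ell q j == ell p i) (fun _ _ => 1%N)) /=.
rewrite [RHS](bigD1 p) //= (big_pred1 i) ?add1n // => k.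
by apply/eqP/eqP => [/ell_inj|->].
Qed.

(** Both sides run over the ordered pairs of distinct points on a common line, a symmetric relation.
    This is how [al] cancels along each line. *)
Lemma sum_other_points_swap (f : P -> nat) :
  (\sum_p \sum_i \sum_(q in other_points p i) f q = \sum_p \sum_i #|other_points p i| * f p)%N.
Proof.
have exch (g : P -> P -> nat) : (\sum_p \sum_i \sum_(q | q != p) \sum_(j | ell q j == ell p i) g p q
   = \sum_p \sum_q \sum_(i : 'I_d) \sum_(j | ell q j == ell p i) (q != p) * g p q)%N.
  apply: eq_bigr => p _; rewrite [RHS]exchange_big /=; apply: eq_bigr => i _.
  rewrite big_mkcond; apply: eq_bigr => q _; case: (q != p).
    by apply: eq_bigr => j _; rewrite mul1n.
  by rewrite big1.
under eq_bigr do under eq_bigr do rewrite sum_other_points.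
rewrite (exch (fun _ q => f q)).
under [RHS]eq_bigr do under eq_bigr do rewrite -sum_nat_const sum_other_points.
rewrite (exch (fun p _ => f p)) exchange_big /=.
apply: eq_bigr => p _; apply: eq_bigr => q _.
transitivity (\sum_(i : 'I_d) \sum_(j : 'I_d) (ell p j == ell q i) * ((p != q) * f p))%N.
  apply: eq_bigr => i _; rewrite big_mkcond; apply: eq_bigr => j _.
  by case: ifP; rewrite ?mul1n ?mul0n.
rewrite exchange_big /=; apply: eq_bigr => i _; rewrite [RHS]big_mkcond.
by apply: eq_bigr => j _; rewrite eq_sym [p == q]eq_sym; case: ifP; rewrite ?mul1n ?mul0n.
Qed.

Variable R : realType.

Section FixedZ.
Variables (z : R) (N : nat).
Hypotheses (z0 : 0 < z) (z1 : z < 1) (d0 : (0 < d)%N).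
Let zX_ge0 k : 0 <= z ^+ k. Proof. by rewrite exprn_ge0 // ltW. Qed.

(** With [n = t + |g|], the term of [p] itself cancels [- g i]. Bounding truncated differences below
    by true ones leaves for each [i] a condition on [g i] alone, and the sum over [g] factors. *)
Lemma weight_le (al : P -> nat) p :
  weight (R := R) incident z N [set: P] (raise al p) p <=
  \sum_(t < N.+1) z ^+ t * \prod_(i < d) \sum_(g < N.+1 |
     (#|other_points p i| * g + \sum_(q in other_points p i) al q
        <= t + #|other_points p i| * (al p).+1)%N) z ^+ g.
Proof.
pose cond t (i : 'I_d) (g : nat) :=
  (#|other_points p i| * g + \sum_(q in other_points p i) al q <= t + #|other_points p i| * (al p).+1)%N.
pose low n := low_set incident [set: P] (raise al p) n N p.
have split_sum i (g : 'I_N.+1) : (\sum_(q in [set: P] | incident p i q)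
     (g + raise al p q - raise al p p)
   = g + \sum_(q in other_points p i) (g + al q - (al p).+1))%N.
  rewrite (bigD1 p) /=; last by rewrite inE; apply/existsP; exists i.
  rewrite addnK; congr (_ + _)%N; apply: eq_big => [q|q]; first by rewrite !inE.
  by move=> /andP[_ qp]; rewrite /raise (negPf qp) eqxx addn0 addn1.
have lowP n g : g \in low n -> forall i, (\sum_j g j - g i + (g i +
    \sum_(q in other_points p i) (g i + al q - (al p).+1)) <= n)%N.
  by rewrite inE => /forallP H i; have := H i; rewrite split_sum.
have g_le (g : {ffun 'I_d -> 'I_N.+1}) i : (g i <= \sum_j g j)%N.
  by rewrite (bigD1 i) //= leq_addr.
have low_ge n g : g \in low n -> (\sum_j g j <= n)%N.
  move=> /lowP/(_ (Ordinal d0)); have := g_le g (Ordinal d0).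
  by rewrite addnA => ?; rewrite subnK //; apply: leq_trans; rewrite leq_addr.
have low_cond t (g : {ffun 'I_d -> 'I_N.+1}) : g \in low (t + \sum_j g j)%N -> [forall i, cond t i (g i)].
  move=> /lowP H; apply/forallP => i; have := H i; have gi := g_le g i.
  rewrite addnA subnK // addnC leq_add2r => Ht; rewrite /cond.
  apply: (@leq_trans (\sum_(q in other_points p i) (g i + al q - (al p).+1)
     + \sum_(q in other_points p i) (al p).+1)%N); last first.
    by rewrite sum_nat_const leq_add2r.
  rewrite -sum_nat_const -!big_split /=; apply: leq_sum => q _.
  by rewrite [leqRHS]addnC -leq_subLR.
rewrite /weight; have -> : \sum_(n < N.+1) #|low n|%:R * z ^+ n
    = \sum_(g : {ffun 'I_d -> 'I_N.+1}) \sum_(n < N.+1 | g \in low n) z ^+ n.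
  under [RHS]eq_bigr do rewrite big_mkcond.
  rewrite exchange_big /=; apply: eq_bigr => n _.
  by rewrite -big_mkcond /= sumr_const mulr_natl.
apply: (@le_trans _ _ (\sum_(g : {ffun 'I_d -> 'I_N.+1})
    \sum_(t < N.+1 | [forall i, cond t i (g i)]) z ^+ (t + \sum_j g j))).
  apply: ler_sum => g _.
  apply: le_trans (ler_sum_shift (P := fun n => g \in low n) (m' := N.+1)
    (s := (\sum_j g j)%N) zX_ge0 _) _.
    by move=> n nN gn; rewrite low_ge //= ltn_addr.
  rewrite big_mkcond [leRHS]big_mkcond; apply: ler_sum => t _.
  by case: ifP => [/low_cond ->|_] //; case: ifP.
under eq_bigr do rewrite big_mkcond.
rewrite exchange_big /= le_eqVlt; apply/orP; left; apply/eqP.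
apply: eq_bigr => t _; rewrite -big_mkcond /= bigA_distr_big_dep mulr_sumr.
apply: eq_big => [g|g _].
  by apply/forallP/familyP => H i; have := H i.
by rewrite exprD prodrXr.
Qed.

(** Hoelder's inequality splits each weight over the lines at the point, and [shifted_sum_le] bounds
    each flag. By [sum_other_points_swap] the exponents [a] and [b] differ in total by the number of
    pairs, whatever [al] is. *)
Lemma prod_weight_le (al : P -> nat) (T : R) : 0 <= T ->
    (forall p, T <= weight incident z N [set: P] (raise al p) p) ->
  z ^+ (\sum_p \sum_i #|other_points p i|) * (\prod_(p : P) T ^+ d) <=
  \prod_(p : P) \prod_(i < d) (((1 - z)^-1) ^+ d.+1 *
    \prod_(k < d) ((1 - z ^+ k.+1) / (1 - z ^+ (#|other_points p i| + k.+1)))).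
Proof.
move=> T0 TW; pose b p i := (\sum_(q in other_points p i) al q)%N.
pose a p i := (#|other_points p i| * (al p).+1)%N.
have sab : (\sum_p \sum_i a p i = \sum_p \sum_i #|other_points p i| + \sum_p \sum_i b p i)%N.
  rewrite sum_other_points_swap -big_split /=; apply: eq_bigr => p _.
  by rewrite -big_split /=; apply: eq_bigr => i _; rewrite /a mulnS.
pose X p i : R := \sum_(t < N.+1) z ^+ t * (\sum_(g < N.+1 |
     (#|other_points p i| * g + b p i <= t + a p i)%N) z ^+ g) ^+ d.
have TX p : T ^+ d <= \prod_i X p i.
  apply: (@le_trans _ _ (weight incident z N [set: P] (raise al p) p ^+ d)).
    by apply: lerXn2r; rewrite ?nnegrE ?(le_trans T0).
  apply: (@le_trans _ _ ((\sum_(t < N.+1) z ^+ t * \prod_(i < d) \sum_(g < N.+1 |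
      (#|other_points p i| * g + b p i <= t + a p i)%N) z ^+ g) ^+ d)).
    by apply: lerXn2r; rewrite ?nnegrE ?weight_le ?(le_trans T0) //;
       apply: le_trans (weight_le _ _); apply: le_trans (TW p).
  apply: (holder_prod (w := fun t : 'I_N.+1 => z ^+ t)
    (x := fun (i : 'I_d) (t : 'I_N.+1) => \sum_(g < N.+1 |
      (#|other_points p i| * g + b p i <= t + a p i)%N) z ^+ g)) => // i t.
  by apply: sumr_ge0.
have zb : 0 < z ^+ (\sum_p \sum_i b p i) by rewrite exprn_gt0.
rewrite -(ler_pM2l zb) mulrA -exprD addnC -sab.
rewrite -!prodrXr -!big_split /=; apply: ler_prod => p _.
apply/andP; split; first by rewrite mulr_ge0 // exprn_ge0.
apply: (@le_trans _ _ (\prod_i (z ^+ a p i * X p i))).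
  by rewrite big_split /= -prodrXr ler_wpM2l ?prodr_ge0 // => i _.
rewrite -prodrXr -big_split /=; apply: ler_prod => i _.
rewrite shifted_sum_le // andbT mulr_ge0 // sumr_ge0 // => t _.
by rewrite mulr_ge0 // exprn_ge0 // sumr_ge0.
Qed.

End FixedZ.
End Flags.

(** The quotient is one of geometric sums, whose terms lie between a power of [z] and 1. The loss
    [z ^+ b.+1] disappears in [le_of_powers]. *)
Lemma qratio_le (R : realType) (z : R) a b : 0 < z -> z < 1 ->
  (1 - z ^+ a.+1) / (1 - z ^+ b.+1) * (z ^+ b.+1 * b.+1%:R) <= a.+1%:R.
Proof.
move=> z0 z1; have z1' : 0 < 1 - z by rewrite subr_gt0.
have zb : 0 < 1 - z ^+ b.+1 by rewrite subr_gt0 exprn_ilt1 ?ltW.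
rewrite mulrAC ler_pdivrMr // -!geometric_sum.
have leA : \sum_(i < a.+1) z ^+ i <= a.+1%:R.
  rewrite -[X in _ <= X%:R]card_ord -sumr_const; apply: ler_sum => i _.
  by rewrite exprn_ile1 ?ltW.
have leB : z ^+ b.+1 * b.+1%:R <= \sum_(i < b.+1) z ^+ i.
  rewrite mulr_natr -[X in _ *+ X]card_ord -sumr_const; apply: ler_sum => i _.
  by apply: ler_wiXn2l; [exact: ltW|exact: ltW|exact: ltnW].
rewrite -mulrA [leRHS]mulrCA; apply: ler_wpM2l; first exact: ltW.
apply: ler_pM => //; first by apply: sumr_ge0 => i _; rewrite exprn_ge0 ?ltW.
by rewrite mulr_ge0 // exprn_ge0 // ltW.
Qed.

Lemma rbinom_pred (R : realType) (M : R) d : (0 < d)%N ->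
  (M - d%:R + 1) * rbinom M d.-1 = d%:R * rbinom M d.
Proof.
case: d => // d _; rewrite /rbinom /= big_ord_recr /= factS natrM invfM.
have d0 : d.+1%:R != 0 :> R by rewrite pnatr_eq0.
have f0 : d`!%:R != 0 :> R by rewrite pnatr_eq0 -lt0n fact_gt0.
by rewrite -natr1 in d0 *; field; rewrite f0.
Qed.

Section Flags.
Variables (R : realType) (d : nat) (P Lt : finType) (ell : P -> 'I_d -> Lt).
Hypothesis ell_inj : forall p, injective (ell p).
Hypotheses (d0 : (0 < d)%N) (P0 : (0 < #|P|)%N).
Hypothesis card_low : forall N (B : {set P}) (al : P -> nat) n,
  (n <= N)%N -> B != finset.set0 ->
  (#|[set g : {ffun 'I_d -> 'I_N.+1} | (\sum_j g j <= n)%N]|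
     <= \sum_(p in B) #|low_set (incident ell) B al n N p|)%N.

(** The limit of [prod_weight_le] for [z -> 1], with [al] balanced at a level [T] near the equal
    share of the total weight. *)
Lemma prod_multiplicity_le :
  \prod_p \prod_(i < d) \prod_(k < d) ((multiplicity ell (ell p i))%:R + k%:R)
    <= \prod_(p : P) \prod_(i < d) (#|P|%:R * d`!%:R) :> R.
Proof.
pose c p i := #|other_points ell p i|.
have cE p i k : (multiplicity ell (ell p i))%:R + k%:R = (c p i + k.+1)%:R :> R.
  by rewrite -(card_other_points ell_inj) -natrD addSnnS.
under eq_bigr do under eq_bigr do under eq_bigr do rewrite cE.
(* The three sums collect the powers of [z] from [prod_weight_le], from the factor [z] in each [T],
   and from [qratio_le]. *)
pose E := (\sum_p \sum_i c p i + \sum_(p : P) \sum_(i < d) 1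
  + \sum_p \sum_(i < d) \sum_(k < d) (c p i + k.+1))%N.
apply: (@le_of_powers _ _ _ E).
  by do 3 (apply: prodr_ge0 => ? _).
move=> z z0 z1; have z1' : 0 < 1 - z by rewrite subr_gt0.
have J0 : 0 < #|P|%:R :> R by rewrite ltr0n.
pose K := ((1 - z)^-1) ^+ d.+1; have K0 : 0 < K by rewrite exprn_gt0 ?invr_gt0.
have [N NP] := exists_total_weight_gt d z0 z1; rewrite -/K in NP.
pose T := z * K / #|P|%:R.
have T0 : 0 <= T by rewrite /T divr_ge0 ?mulr_ge0 ?ltW.
have TD : #|P|%:R * T < total_weight d z N by rewrite /T mulrC divfK ?gt_eqF.
have [al alT] := exists_balanced z0 (card_low (N := N)) T0 TD.
have := prod_weight_le ell_inj z0 z1 d0 T0 (fun p => ltW (alT p)).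
rewrite -/K => main.
(* Multiplying by [s p i] clears [T] up to a factor [z] and supplies the factors that [qratio_le]
   requires. *)
pose s p i : R := #|P|%:R / K * \prod_(k < d) (z ^+ (c p i + k.+1) * (c p i + k.+1)%:R).
have s0 p i : 0 < s p i.
  rewrite mulr_gt0 ?divr_gt0 //; apply: prodr_gt0 => k _.
  by rewrite mulr_gt0 ?exprn_gt0 // addnS ltr0n.
have S0 : 0 < \prod_p \prod_(i < d) s p i by do 2 (apply: prodr_gt0 => ? _).
rewrite -(ler_pM2r S0) in main.
have -> : z ^+ E * \prod_p \prod_(i < d) \prod_(k < d) (c p i + k.+1)%:R
    = z ^+ (\sum_p \sum_i c p i) * (\prod_(p : P) T ^+ d) * \prod_p \prod_(i < d) s p i.
  rewrite /E !exprD -!mulrA; congr (_ * _).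
  rewrite -!prodrXr -!big_split /=; apply: eq_bigr => p _.
  have -> : T ^+ d = \prod_(i < d) T by rewrite prodr_const card_ord.
  rewrite -!prodrXr -!big_split /=; apply: eq_bigr => i _.
  rewrite /s /T -prodrXr expr1 mulrA -[in LHS]mulrA -big_split /= [RHS]mulrA.
  congr (_ * _).
  by field; rewrite ?gt_eqF.
apply: (le_trans main); rewrite -big_split /=; apply: ler_prod => p _.
have lb0 i : 0 <= \prod_(k < d) ((1 - z ^+ k.+1) / (1 - z ^+ (c p i + k.+1))).
  apply: prodr_ge0 => k _.
  by rewrite divr_ge0 // subr_ge0 exprn_ile1 ?ltW.
have fl i : 0 <= K * \prod_(k < d) ((1 - z ^+ k.+1) / (1 - z ^+ (c p i + k.+1))) * s p i.
  by apply: mulr_ge0; [apply: mulr_ge0; [exact: ltW|exact: lb0]|exact: ltW].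
rewrite -big_split /=; apply/andP; split; first by apply: prodr_ge0 => i _; exact: fl.
apply: ler_prod => i _; apply/andP; split; first exact: fl.
rewrite /s; set u := \prod_(k < d) (_ / _); set v := \prod_(k < d) (_ * _).
have -> : K * u * (#|P|%:R / K * v) = #|P|%:R * (u * v) by field; rewrite gt_eqF.
rewrite ler_pM2l // /u /v -big_split /= fact_prod natr_prod big_add1 /= big_mkord.
apply: ler_prod => k _; rewrite addnS qratio_le // andbT.
by rewrite !mulr_ge0 ?exprn_ge0 ?invr_ge0 ?subr_ge0 ?exprn_ile1 ?ltW.
Qed.

(** By [rbinom_pred] there are [x * #|Lt|] flags, while the sum of [x / m] over the flags is [x]
    times the number of lines carrying a flag. Thus [eq_of_prod_rising_le] applies. *)
Lemma multiplicity_eq (M : R) : d%:R <= M ->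
    #|P|%:R = rbinom M d -> #|Lt|%:R = rbinom M d.-1 ->
  forall l, (multiplicity ell l)%:R = M - d%:R + 1.
Proof.
move=> dM cP cL; pose x := M - d%:R + 1.
have x0 : 0 < x by rewrite /x; lra.
have prodx : \prod_(k < d) (x + k%:R) = #|P|%:R * d`!%:R.
  rewrite cP /rbinom divfK ?pnatr_eq0 -?lt0n ?fact_gt0 //.
  rewrite (reindex_inj rev_ord_inj) /=; apply: eq_bigr => k _.
  by rewrite natrB // -natr1 /x; ring.
have Lx : x * #|Lt|%:R = #|{: P * 'I_d}|%:R.
  by rewrite cL /x rbinom_pred // -cP card_prod card_ord mulrC natrM.
pose m (e : P * 'I_d) : R := (multiplicity ell (ell e.1 e.2))%:R.
have m0 e : 0 < m e.
  by rewrite ltr0n; apply/card_gt0P; exists e; rewrite inE.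
pose L1 := [set l | (0 < multiplicity ell l)%N].
have sumL1 : \sum_e x / m e = x * #|L1|%:R.
  rewrite -mulr_sumr; congr (_ * _).
  rewrite (partition_big (fun e : P * 'I_d => ell e.1 e.2) predT) //=.
  rewrite -sum1_card natr_sum [RHS]big_mkcond; apply: eq_bigr => l _.
  rewrite (eq_bigr (fun=> (multiplicity ell l)%:R^-1)) => [|e /eqP <- //].
  rewrite sumr_const inE; have -> : #|[pred e : P * 'I_d | ell e.1 e.2 == l]| = multiplicity ell l.
    by apply: eq_card => e; rewrite !inE.
  case: posnP => [->|m1]; first by rewrite mulr0n.
  by rewrite -[LHS]mulr_natl divff // pnatr_eq0 -lt0n.
have L1L : (#|L1| <= #|Lt|)%N by exact: max_card.
have mx : forall e, m e = x.
  apply: (@eq_of_prod_rising_le _ _ d) => //.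
    rewrite sumL1 -Lx.
    by rewrite ler_pM2l ?ler_nat.
  have -> : \prod_e \prod_(k < d) (m e + k%:R)
      = \prod_p \prod_(i < d) \prod_(k < d) ((multiplicity ell (ell p i))%:R + k%:R).
    by rewrite [RHS](pair_bigA _ (fun p i => \prod_(k < d) ((multiplicity ell (ell p i))%:R + k%:R))).

  apply: (le_trans prod_multiplicity_le); rewrite pair_bigA /=.
  by rewrite le_eqVlt; apply/orP; left; apply/eqP; apply: eq_bigr => e _; rewrite prodx.
(* Since [m = x] at every flag, the sum is the number of flags, so every line carries one. *)
have /setP L1T : L1 = [set: Lt].
  apply/eqP; rewrite eqEcard finset.subsetT cardsT -(ler_nat R) -(ler_pM2l x0) -sumL1 Lx.
  rewrite (eq_bigr (fun=> 1)) => [|e _]; last by rewrite mx divff ?gt_eqF.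
  by rewrite sumr_const; exact: lexx.
move=> l; have := L1T l; rewrite !inE => /card_gt0P[e]; rewrite inE => /eqP <-.
exact: mx.
Qed.
End Flags.

(** * Affine forms *)

Section AffineForms.
Variables (F : fieldType) (d : nat).
Implicit Types (p q v w x : 'rV[F]_d) (a : 'cV[F]_d) (f g h : {mpoly F[d]}).

Definition ev x f : F := f.@[fun k => x 0 k].
HB.instance Definition _ x := GRing.RMorphism.copy (ev x) (meval (fun k => x 0 k)).
HB.instance Definition _ x := GRing.Linear.copy (ev x) (meval (fun k => x 0 k)).

Lemma evX x k : ev x 'X_k = x 0 k. Proof. exact: mevalXU. Qed.
Lemma evC x c : ev x c%:MP = c. Proof. exact: mevalC. Qed.
Lemma evZ x c f : ev x (c *: f) = c * ev x f. Proof. exact: mevalZ. Qed.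

Definition restrict p v : {mpoly F[d]} -> {poly F} :=
  mmap polyC (fun k => (p 0 k)%:P + v 0 k *: 'X).
HB.instance Definition _ p v := GRing.RMorphism.copy (restrict p v) (restrict p v).

Lemma restrictC p v c : restrict p v c%:MP = c%:P.
Proof. exact: mmapC. Qed.

Lemma restrictX p v k : restrict p v 'X_k = (p 0 k)%:P + v 0 k *: 'X.
Proof. by rewrite /restrict mmapX mmap1U. Qed.

Lemma restrictZ p v c f : restrict p v (c *: f) = c *: restrict p v f.
Proof. by rewrite -mul_mpolyC rmorphM /= restrictC mul_polyC. Qed.

Lemma horner_restrict p v f t : (restrict p v f).[t] = ev (p + t *: v) f.
Proof.
apply: (mpoly_rmorph_ext (g := horner_eval t \o restrict p v)
  (h := ev (p + t *: v))) => [c|k] /=; rewrite /horner_eval.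
  by rewrite restrictC hornerC evC.
by rewrite restrictX evX !hornerE !mxE mulrC.
Qed.

Lemma size_restrict p v f : (size (restrict p v f) <= msize f)%N.
Proof.
rewrite /restrict /mmap big_seq; apply: (leq_trans (size_sum _ _ _)).
apply/bigmax_leqP_seq => m _ mf; rewrite mul_polyC; apply: (leq_trans (size_scale_leq _ _)).
apply: leq_trans (msize_mdeg_lt mf); rewrite mdegE /mmap1.
elim/big_rec2: _ => [|i k g _ IH]; first by rewrite size_poly1.
have lin : (size ((p 0 i)%:P + v 0 i *: 'X)%R <= 2)%N.
  apply: (leq_trans (size_polyD _ _)); rewrite geq_max; apply/andP; split.
    by apply: leq_trans (size_polyC_leq1 _) _.
  by apply: leq_trans (size_scale_leq _ _) _; rewrite size_polyX.
have linX j : (size (((p 0 i)%:P + v 0 i *: 'X) ^+ j)%R <= j.+1)%N.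
  apply: leq_trans (size_poly_exp_leq _ _) _; rewrite ltnS -[leqRHS]mul1n leq_mul2r.
  by move: lin; case: size => [|[|[|]]] //= *; rewrite ?orbT.
apply: leq_trans (size_polyMleq _ _) _.
by rewrite -subn1 leq_subLR add1n -addnS -addSn leq_add.
Qed.

Lemma restrict_frame p (A : 'M[F]_d) i f :
  restrict p (row i A) f = restrict 0 (delta_mx 0 i) (frame p A f).
Proof.
apply: (mpoly_rmorph_ext (h := restrict 0 (delta_mx 0 i) \o frame p A)) => [c|k] /=.
  by rewrite frameC !restrictC.
rewrite frameX restrictX rmorphD /= restrictC rmorph_sum /=; congr (_ + _).
rewrite (bigD1 i) //= big1 ?addr0 => [|j /negPf ji].
  by rewrite restrictZ restrictX !mxE !eqxx /= add0r scale1r.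
by rewrite restrictZ restrictX !mxE ji andbF scale0r addr0 scaler0.
Qed.

Lemma coef_restrict_delta i g k :
  (restrict 0 (delta_mx 0 i) g)`_k = g@_(U_(i) *+ k).
Proof.
rewrite {1}(mpolyE g) rmorph_sum coef_sum [in RHS](mpolyE g) raddf_sum /=.
apply: eq_bigr => m _; rewrite restrictZ coefZ mcoeffZ mcoeffX; congr (_ * _).
have -> : restrict 0 (delta_mx 0 i) 'X_[m] = 'X^(m i) *+ (m == U_(i) *+ m i)%MM.
  rewrite mpolyXE_id rmorph_prod /= (bigD1 i) //= rmorphXn /= restrictX !mxE !eqxx /=.
  rewrite add0r scale1r; case: eqVneq => [mE|mE].
    rewrite big1 ?mulr1 // => j ji.
    have -> : m j = 0%N by rewrite mE mulmnE mnm1E eq_sym (negPf ji) mul0n.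
    by rewrite expr0 rmorph1.
  have [j /andP[ji mj]] : exists j, (j != i) && (m j != 0%N).
    apply/existsP; apply: contraNT mE; rewrite negb_exists => /forallP mE.
    apply/eqP/mnmP => j; rewrite mulmnE mnm1E.
    have := mE j; rewrite negb_and !negbK; case: eqVneq => [-> _|_ /eqP ->].
      by rewrite mul1n.
    by rewrite mul0n.
  rewrite (bigD1 j) //= rmorphXn /= restrictX !mxE (negPf ji) andbF scale0r addr0.
  by rewrite expr0n (negPf mj) mul0r mulr0.
rewrite coefMn coefXn; case: (eqVneq m (U_(i) *+ k)%MM) => [mk|mk].
  by rewrite mk mulmnE mnm1E eqxx mul1n !eqxx.
case: (eqVneq k (m i)) => [km|_]; last by rewrite mul0rn.
by rewrite -km (negPf mk) mulr0n.
Qed.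

Definition aff a q : {mpoly F[d]} := \sum_k a k 0 *: ('X_k - (q 0 k)%:MP).

Lemma ev_aff x a q : ev x (aff a q) = ((x - q) *m a) 0 0.
Proof.
rewrite /aff raddf_sum mxE; apply: eq_bigr => k _ /=.
by rewrite evZ rmorphB /= evX evC !mxE mulrC.
Qed.

Lemma restrict_aff p v a q :
  restrict p v (aff a q) = (((p - q) *m a) 0 0)%:P + ((v *m a) 0 0) *: 'X.
Proof.
rewrite /aff rmorph_sum !mxE /= rmorph_sum /= scaler_suml -big_split /=.
apply: eq_bigr => k _; rewrite restrictZ rmorphB /= restrictX restrictC !mxE.
rewrite polyCM polyCD polyCN -!mul_polyC polyCM; ring.
Qed.

Lemma msize_aff a q : (msize (aff a q) <= 2)%N.
Proof.
rewrite /aff; apply: (leq_trans (msize_sum _ _ _)); apply/bigmax_leqP => k _.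
apply: (leq_trans (msizeZ_le _ _)); apply: (leq_trans (msizeD_le _ _)).
rewrite geq_max msizeX mdeg1 msizeN msizeC; by case: (_ != 0).
Qed.

Lemma exists_dual a : a != 0 -> exists w : 'rV[F]_d, (w *m a) 0 0 = 1.
Proof.
move=> a0; have [k ak] : exists k, a k 0 != 0.
  apply/existsP; apply: contraNT a0; rewrite negb_exists => /forallP a0.
  by apply/eqP/matrixP => k j; rewrite ord1 mxE; apply/eqP; have := a0 k; rewrite negbK.
exists ((a k 0)^-1 *: delta_mx 0 k).
by rewrite -scalemxAl -rowE !mxE mulVf.
Qed.

Lemma aff_neq0 a q : a != 0 -> aff a q != 0.
Proof.
move=> /exists_dual[w wa]; apply: contra_neq (oner_neq0 F) => h0.
have <- : ev (q + w) (aff a q) = 1 by rewrite ev_aff addrC addKr.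
by rewrite h0 raddf0.
Qed.

Lemma msize_aff_neq0 a q : a != 0 -> msize (aff a q) = 2.
Proof.
move=> a0; apply/eqP; rewrite eqn_leq msize_aff ltnNge; apply/negP => /msize1_polyC hC.
have [w wa] := exists_dual a0.
have : ev (q + w) (aff a q) = ev q (aff a q) by rewrite hC !evC.
rewrite !ev_aff subrr mul0mx addrC addKr wa mxE => /eqP.
by rewrite oner_eq0.
Qed.

Lemma msize_prod_aff (I : finType) (E : {set I}) (a' : I -> 'cV[F]_d) (q' : I -> 'rV[F]_d) :
  (forall e, a' e != 0) -> msize (\prod_(e in E) aff (a' e) (q' e)) = #|E|.+1.
Proof.
move=> a'0; rewrite -sum1_card.
suff [] : \prod_(e in E) aff (a' e) (q' e) != 0 /\
  msize (\prod_(e in E) aff (a' e) (q' e)) = (\sum_(e in E) 1).+1 by [].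
elim/big_rec2: _ => [|e g m _ [g0 IH]]; first by rewrite oner_neq0 msize1.
by rewrite mulf_neq0 ?aff_neq0 // msizeM ?aff_neq0 // msize_aff_neq0 // IH.
Qed.

Lemma aff_scale c a q : aff (c *: a) q = c *: aff a q.
Proof.
by rewrite /aff scaler_sumr; apply: eq_bigr => k _; rewrite mxE scalerA.
Qed.

Lemma aff_base a p q : ((q - p) *m a) 0 0 = 0 -> aff a p = aff a q.
Proof.
move=> qp0; apply/eqP; rewrite -subr_eq0 /aff -sumrB; apply/eqP.
transitivity ((((q - p) *m a) 0 0)%:MP : {mpoly F[d]}); last by rewrite qp0 mpolyC0.
rewrite mxE raddf_sum; apply: eq_bigr => k _ /=.
rewrite -scalerBr !mxE mulrC mpolyCM mul_mpolyC; congr (_ *: _).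
by rewrite mpolyCB; ring.
Qed.

Definition mdvd h f := exists g, f = h * g.

(* The substitution onto the hyperplane [aff a q = 0] along [w] has kernel
   generated by [aff a q], which is therefore prime. *)
Definition proj_aff a q w : {mpoly F[d]} -> {mpoly F[d]} :=
  comp_mpoly [tuple 'X_k - w 0 k *: aff a q | k < d].
HB.instance Definition _ a q w := GRing.RMorphism.copy (proj_aff a q w) (proj_aff a q w).

Lemma proj_affX a q w k : proj_aff a q w 'X_k = 'X_k - w 0 k *: aff a q.
Proof. by rewrite /proj_aff comp_mpolyXU -tnth_nth tnth_mktuple. Qed.

Lemma proj_affC a q w c : proj_aff a q w c%:MP = c%:MP.
Proof. exact: comp_mpolyC. Qed.

Lemma proj_aff_aff a q w a' q' :
  proj_aff a q w (aff a' q') = aff a' q' - ((w *m a') 0 0) *: aff a q.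
Proof.
rewrite [in LHS]/aff rmorph_sum [aff a' q']/aff mxE scaler_suml -sumrB.
apply: eq_bigr => k _; rewrite -mul_mpolyC rmorphM /= proj_affC rmorphB /= proj_affX proj_affC.
by rewrite !mul_mpolyC [_ - _ *: _ - _]addrAC [LHS]scalerBr scalerA [a' k 0 * _]mulrC.
Qed.

Lemma proj_affP a q w f : (w *m a) 0 0 = 1 ->
  (proj_aff a q w f = 0) <-> mdvd (aff a q) f.
Proof.
move=> wa; split=> [f0|[g ->]]; last first.
  by rewrite rmorphM /= proj_aff_aff wa scale1r subrr mul0r.
(* This divisibility holds for the variables and is stable under sums and products. *)
suff [g fg] : mdvd (aff a q) (f - proj_aff a q w f) by exists g; rewrite -fg f0 subr0.
pose D f := mdvd (aff a q) (f - proj_aff a q w f).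
have DM f1 f2 : D f1 -> D f2 -> D (f1 * f2).
  move=> [g1 E1] [g2 E2]; exists (g1 * f2 + proj_aff a q w f1 * g2).
  by rewrite rmorphM /= mulrDr mulrA -E1 mulrCA -E2; ring.
have D1 : D 1 by exists 0; rewrite rmorph1 subrr mulr0.
have DX k : D 'X_k.
  by exists (w 0 k)%:MP; rewrite proj_affX opprB addrC subrK mulrC mul_mpolyC.
rewrite -/(D f) (mpolyE f); elim/big_ind: _ => [|f1 f2 [g1 E1] [g2 E2]|m _].
- by exists 0; rewrite rmorph0 subrr mulr0.
- by exists (g1 + g2); rewrite rmorphD /= mulrDr -E1 -E2 opprD addrACA.
rewrite -mul_mpolyC; apply: (DM); first by exists 0; rewrite proj_affC subrr mulr0.
rewrite mpolyXE_id; elim/big_ind: _ => [||k _]; [exact: D1|exact: DM|].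
by elim: (m k) => [|j IH]; rewrite ?expr0 // exprS; apply: DM.
Qed.

Lemma aff_prime a q f g : a != 0 ->
  mdvd (aff a q) (f * g) -> mdvd (aff a q) f \/ mdvd (aff a q) g.
Proof.
move=> /exists_dual[w wa] /(proj_affP _ _ wa)/eqP.
rewrite rmorphM mulf_eq0 => /orP[] /eqP /(proj_affP _ _ wa); by [left|right].
Qed.

Definition assoc h g := exists2 c, c != 0 & g = c *: h.

Lemma assoc_sym h g : assoc h g -> assoc g h.
Proof.
by move=> [c c0 ->]; exists c^-1; rewrite ?invr_eq0 // scalerA mulVf // scale1r.
Qed.

Lemma assoc_trans h g f : assoc h g -> assoc g f -> assoc h f.
Proof.
by move=> [c c0 ->] [b b0 ->]; exists (b * c); rewrite ?mulf_neq0 // scalerA.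
Qed.

Lemma assoc_ev h g x : assoc h g -> (ev x h == 0) = (ev x g == 0).
Proof. by move=> [c c0 ->]; rewrite evZ mulf_eq0 (negPf c0). Qed.

Lemma mdvd_aff_assoc a q a' q' : a != 0 -> a' != 0 ->
  mdvd (aff a q) (aff a' q') -> assoc (aff a q) (aff a' q').
Proof.
move=> /exists_dual[w wa] a'0 /(proj_affP _ _ wa); rewrite proj_aff_aff => /eqP.
rewrite subr_eq0 => /eqP E; exists ((w *m a') 0 0) => //.
by apply: contraTneq (aff_neq0 q' a'0) => w0; rewrite E w0 scale0r eqxx.
Qed.

Lemma mdvd_prod_aff (I : finType) (E : {set I}) (a' : I -> 'cV[F]_d) (q' : I -> 'rV[F]_d) a q c :
    a != 0 -> (forall e, a' e != 0) -> c != 0 ->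
    mdvd (aff a q) (c *: \prod_(e in E) aff (a' e) (q' e)) ->
  exists2 e, e \in E & assoc (aff a q) (aff (a' e) (q' e)).
Proof.
move=> a0 a'0 c0 [g]; move/(congr1 (fun f => c^-1 *: f)).
rewrite scalerA mulVf // scale1r scalerAr => E1.
have {E1} : mdvd (aff a q) (\prod_(e in E) aff (a' e) (q' e)) by exists (c^-1 *: g).
rewrite -big_enum /=.
have : {subset enum E <= E} by move=> e; rewrite mem_enum.
elim: (enum E) => [|e s IH] sub.
  rewrite big_nil => [[f]] /esym f1; have [w wa] := exists_dual a0.
  have := congr1 (ev q) f1; rewrite rmorphM rmorph1 /= ev_aff subrr mul0mx mxE mul0r.
  by move/eqP; rewrite eq_sym oner_eq0.
rewrite big_cons => /(aff_prime a0)[|/IH[]].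
- move=> /(mdvd_aff_assoc a0 (a'0 e)); exists e => //; by rewrite sub ?mem_head.
- by move=> x xs; rewrite sub // inE xs orbT.
- by move=> e' e'E ae'; exists e'.
Qed.

Lemma prod_aff_mdvd (I : finType) (E : {set I}) (a' : I -> 'cV[F]_d) (q' : I -> 'rV[F]_d) f :
    (forall e, a' e != 0) ->
    {in E &, forall e e', assoc (aff (a' e) (q' e)) (aff (a' e') (q' e')) -> e = e'} ->
    (forall e, e \in E -> mdvd (aff (a' e) (q' e)) f) ->
  mdvd (\prod_(e in E) aff (a' e) (q' e)) f.
Proof.
move=> a'0 injE dvdE; rewrite -big_enum /=.
have {dvdE} : forall e, e \in enum E -> mdvd (aff (a' e) (q' e)) f.
  by move=> e; rewrite mem_enum; exact: dvdE.
have := enum_uniq E; have : {subset enum E <= E} by move=> e; rewrite mem_enum.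
elim: (enum E) f => [|e s IH] f /= sub; first by exists f; rewrite big_nil mul1r.
move=> /andP[es us] dvd; have eE : e \in E by rewrite sub ?mem_head.
have sE : {subset s <= E} by move=> x xs; rewrite sub // inE xs orbT.
have [g fg] := dvd e (mem_head _ _); rewrite big_cons.
suff [h gh] : mdvd (\prod_(x <- s) aff (a' x) (q' x)) g by exists h; rewrite fg gh mulrA.
apply: IH => // x xs; have := dvd x; rewrite inE xs orbT fg => /(_ isT).
move=> /(aff_prime (a'0 x))[|//] /(mdvd_aff_assoc (a'0 x) (a'0 e)).
by move=> /(injE _ _ (sE _ xs) eE) xe; move: es; rewrite -xe xs.
Qed.

End AffineForms.

(** Injectivity and [#|K| <= #|I|] force the matrix to be square and invertible. *)
Lemma exists_interpolation (F : fieldType) (I K : finType) (c : I -> K -> F) :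
    (#|K| <= #|I|)%N ->
    (forall a : I -> F, (forall k, \sum_i a i * c i k = 0) -> forall i, a i = 0) ->
  forall b : K -> F, exists a : I -> F, forall k, \sum_i a i * c i k = b k.
Proof.
move=> KI inj b; pose M := \matrix_(i < #|I|, k < #|K|) c (enum_val i) (enum_val k).
have sumE (v : 'rV[F]_#|I|) k : (v *m M) 0 (enum_rank k)
    = \sum_i v 0 (enum_rank i) * c i k.
  rewrite mxE [RHS](reindex (@enum_val I predT)) /=; last first.
    by apply: onW_bij; exact: enum_val_bij.
  by apply: eq_bigr => i _; rewrite mxE enum_valK enum_rankK.
have Mfree : row_free M.
  rewrite -kermx_eq0; apply/rowV0P => v /sub_kermxP vM; apply/rowP => i.
  rewrite mxE -(enum_valK i); apply: (inj (fun i => v 0 (enum_rank i))) => k.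
  by rewrite -sumE vM mxE.
have Mfull : row_full M.
  rewrite /row_full eqn_leq rank_leq_col (leq_trans KI) //.
  by rewrite (eqP Mfree).
have /submxP[v vM] := submx_full (\row_k b (enum_val k)) Mfull.
exists (fun i => v 0 (enum_rank i)) => k; rewrite -sumE -vM mxE enum_rankK //.
Qed.

(** * Lagrange polynomials on the joints *)

Section LagrangePolynomials.
Variables (F : fieldType) (d n : nat) (P Lt : finType).
Variables (pt : P -> 'rV[F]_d) (A : P -> 'M[F]_d) (ell : P -> 'I_d -> Lt).
Hypotheses (d0 : (0 < d)%N) (pt_inj : injective pt).
Hypothesis A_unit : forall p, A p \in unitmx.
Hypothesis ell_inj : forall p, injective (ell p).
Hypothesis same_line : forall p i q j, ell q j = ell p i ->
  exists t c, [/\ c != 0, pt q = pt p + t *: row i (A p) & row j (A q) = c *: row i (A p)].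
Hypothesis mult : forall l, multiplicity ell l = n.+1.
Hypothesis cardP : #|P| = 'C(n + d, d).

Implicit Types (p q r : P) (i j k : 'I_d) (f g : {mpoly F[d]}).

Let v p i := row i (A p).
(** The basis dual to the directions at [p], so that [hform p i] vanishes on all chosen lines at [p]
    but the [i]-th. *)
Definition normal p i : 'cV[F]_d := col i (invmx (A p)).
Definition hform p i : {mpoly F[d]} := aff (normal p i) (pt p).

Lemma dual_normal p i j : (v p j *m normal p i) 0 0 = (j == i)%:R.
Proof.
by rewrite /v /normal colE mulmxA -row_mul mulmxV // -colE !mxE.
Qed.

Lemma normal_neq0 p i : normal p i != 0.
Proof.
apply: contra_neq (oner_neq0 F) => n0.
by have := dual_normal p i i; rewrite n0 mulmx0 mxE eqxx.
Qed.

Lemma incP p i q : incident ell p i q -> exists t, pt q = pt p + t *: row i (A p).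
Proof. by move=> /existsP[j /eqP/same_line[t [c [_ -> _]]]]; exists t. Qed.

Lemma card_incident p i : #|incident ell p i| = n.+1.
Proof.
rewrite -(mult (ell p i)) -(card_other_points ell_inj) (cardD1 p) inE /=.
have -> : [exists j, ell p j == ell p i] by apply/existsP; exists i.
by rewrite add1n; congr _.+1; apply: eq_card => q; rewrite !inE andbC.
Qed.

(** For [al = 0] each of the [n + 1] joints on the [i]-th line contributes [m i]. *)
Lemma exists_low_monomial_config f e : f != 0 -> (msize f <= e.+1)%N ->
  exists p m, (frame (pt p) (A p) f)@_m != 0 /\ forall i, (mdeg m + n * m i <= e)%N.
Proof.
move=> f0 fe; have P0 : [set: P] != finset.set0.
  by rewrite -card_gt0 cardsT cardP bin_gt0 leq_addl.
have [p [m [_ fm low]]] := exists_low_monomial pt_inj A_unit incP (fun=> 0%N) P0 f0 fe.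
exists p, m; split=> // i; have := low i.
rewrite (eq_bigl (fun q => incident ell p i q)) => [|q]; last by rewrite inE.
rewrite sum_nat_const card_incident addn0 subn0 mulSn addnA subnK //.
by rewrite mdegE (bigD1 i) //= leq_addr.
Qed.

Lemma coef0_frame p f : (frame (pt p) (A p) f)@_0 = ev (pt p) f.
Proof.
pose i := Ordinal d0; have := coef_restrict_delta i (frame (pt p) (A p) f) 0.
rewrite mulm0n => <-; rewrite -restrict_frame -horner_coef0 horner_restrict.
by rewrite scale0r addr0.
Qed.

Lemma eq0_of_points f : (msize f <= n.+1)%N -> (forall p, ev (pt p) f = 0) -> f = 0.
Proof.
move=> fn f0; apply/eqP; apply: contraT => /exists_low_monomial_config/(_ fn)[p [m [fm low]]].
have [m0|] := eqVneq m 0%MM; first by move: fm; rewrite m0 coef0_frame f0 eqxx.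
rewrite -mdeg_eq0 -lt0n => mdeg0.
have [i mi] : exists i, m i != 0%N.
  apply/existsP; apply: contraTT mdeg0; rewrite negb_exists => /forallP mz.
  by rewrite mdegE big1 // => i _; apply/eqP; have := mz i; rewrite negbK.
move: mi; rewrite -lt0n => mi; have := low i; rewrite leqNgt => /negP[].
by rewrite -[X in (X < _)%N]add0n -[X in (0 + X < _)%N]muln1 -addSn leq_add // leq_mul.
Qed.

(** In degree at most [n + 1] the low monomial can only be 1 or a single variable, and its
    coefficient can be read off on a line. *)
Lemma eq0_of_lines f : (msize f <= n.+2)%N ->
  (forall p i, restrict (pt p) (v p i) f = 0) -> f = 0.
Proof.
move=> fn f0; apply/eqP; apply: contraT => /exists_low_monomial_config/(_ fn)[p [m [fm low]]].
suff [i [e mE]] : exists i (e : nat), m = (U_(i) *+ e)%MM.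
  by move: fm; rewrite mE -coef_restrict_delta -restrict_frame f0 coef0 eqxx.
have [m0|] := eqVneq m 0%MM; first by exists (Ordinal d0), 0%N; rewrite mulm0n.
rewrite -mdeg_eq0 -lt0n => mdeg0.
have [i mi] : exists i, m i != 0%N.
  apply/existsP; apply: contraTT mdeg0; rewrite negb_exists => /forallP mz.
  by rewrite mdegE big1 // => i _; apply/eqP; have := mz i; rewrite negbK.
move: mi; rewrite -lt0n => mi; exists i, (m i).
have m1 : mdeg m = 1%N.
  apply/eqP; rewrite eqn_leq mdeg0 andbT -(leq_add2r (n * 1)) add1n muln1.
  by apply: leq_trans (low i); rewrite leq_add2l leq_pmulr.
move/eqP: m1; rewrite mdeg_eq1 => /existsP[j /eqP mE].
move: mi; rewrite mE mnm1E; case: eqVneq => // <- _.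
by rewrite mulm1n.
Qed.

(** There are as many monomials of degree at most [n] as joints, and evaluation at the joints is
    injective by [eq0_of_points]. *)
Lemma exists_lagrange p : exists f : {mpoly F[d]},
  (msize f <= n.+1)%N /\ forall q, ev (pt q) f = (q == p)%:R.
Proof.
pose I : finType := {t : d.-tuple 'I_n.+1 | (\sum_(i <- t) i <= n)%N}.
pose mon (t : I) : 'X_{1..d} := [multinom (tnth (val t) j : nat) | j < d].
have mdegmon t : (mdeg (mon t) <= n)%N.
  rewrite mdegE; have := valP t; rewrite big_tuple; apply: leq_trans.
  by apply: leq_sum => j _; rewrite mnmE.
have mon_inj : injective mon.
  move=> t u /mnmP tu; apply/val_inj/eq_from_tnth => j; apply: val_inj.
  by have := tu j; rewrite !mnmE.
pose poly (a : I -> F) : {mpoly F[d]} := \sum_t a t *: 'X_[mon t].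
have szpoly a : (msize (poly a) <= n.+1)%N.
  apply: (leq_trans (msize_sum _ _ _)); apply/bigmax_leqP => t _.
  by apply: (leq_trans (msizeZ_le _ _)); rewrite msizeX ltnS.
have evpoly a q : ev (pt q) (poly a) = \sum_t a t * ev (pt q) 'X_[mon t].
  by rewrite /poly raddf_sum; apply: eq_bigr => t _; rewrite /= evZ.
have KI : (#|P| <= #|I|)%N.
  rewrite cardP addnC card_sig -card_partial_ord_partitions.
  by apply/eq_leq/eq_card => t; rewrite !inE.
have [|a aP] := exists_interpolation (c := fun t q => ev (pt q) 'X_[mon t]) KI _
    (fun q => (q == p)%:R).
  move=> a a0 t; have p0 : poly a = 0.
    by apply: eq0_of_points => // q; rewrite evpoly.
  have := mcoeff0 F (mon t); rewrite -{1}p0 raddf_sum (bigD1 t) //= mcoeffZ mcoeffX eqxx.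
  rewrite mulr1 big1 ?addr0 // => u ut; rewrite mcoeffZ mcoeffX [_ == _](_ : _ = false) ?mulr0 //.
  by apply: contraNF ut => /eqP/mon_inj ->.
by exists (poly a); split=> // q; rewrite evpoly.
Qed.

Lemma line_poly_eq0 r k (u : {poly F}) (Q : {set P}) :
    (forall q, q \in Q -> incident ell r k q) ->
    (forall q t, q \in Q -> pt q = pt r + t *: v r k -> root u t) ->
  (size u <= #|Q|)%N -> u = 0.
Proof.
move=> Qinc Qroot uQ.
have /all_sig[t tP] q : {t | incident ell r k q ==> (pt q == pt r + t *: v r k)}.
  have [iq|_] := boolP (incident ell r k q); last by exists 0.
  by apply: sigW; have [t ->] := incP iq; exists t; rewrite /= eqxx.
have ptE q : q \in Q -> pt q = pt r + t q *: v r k.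
  by move=> /Qinc iq; move/implyP: (tP q) => /(_ iq)/eqP.
apply: (@roots_geq_poly_eq0 _ u [seq t q | q <- enum Q]).
- apply/allP => _ /mapP[q qQ ->]; rewrite mem_enum in qQ.
  by apply: (Qroot q) => //; exact: ptE.
- rewrite map_inj_in_uniq ?enum_uniq // => q q'; rewrite !mem_enum => qQ q'Q tq.
  by apply: pt_inj; rewrite (ptE q) // (ptE q') // tq.
- by rewrite size_map -cardE.
Qed.

Lemma restrict_same_line p i r k f : ell r k = ell p i ->
  restrict (pt p) (v p i) f = 0 -> restrict (pt r) (v r k) f = 0.
Proof.
move=> /same_line[t [c [_ rE vE]]] f0.
have -> : restrict (pt r) (v r k) f = restrict (pt p) (v p i) f \Po (t%:P + c *: 'X).
  apply: (mpoly_rmorph_ext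
    (h := comp_poly (t%:P + c *: 'X) \o restrict (pt p) (v p i))) => [b|j] /=.
    by rewrite !restrictC comp_polyC.
  rewrite !restrictX comp_polyD comp_polyC comp_polyZ comp_polyX rE /v vE !mxE.
  by rewrite polyCD polyCM -!mul_polyC polyCM; ring.
by rewrite f0 comp_poly0.
Qed.

Lemma ev_hform_line p i j t : ev (pt p + t *: v p j) (hform p i) = t * (j == i)%:R.
Proof.
by rewrite ev_aff addrC addKr -scalemxAl mxE dual_normal.
Qed.

Lemma ev_hform p i : ev (pt p) (hform p i) = 0.
Proof. by rewrite ev_aff subrr mul0mx mxE. Qed.

Lemma restrict_hform p i j :
  restrict (pt p) (v p j) (hform p i) = (j == i)%:R *: 'X.
Proof. by rewrite restrict_aff subrr mul0mx mxE polyC0 add0r dual_normal. Qed.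

Lemma hform_neq0 p i : hform p i != 0.
Proof. exact/aff_neq0/normal_neq0. Qed.

Lemma ev_hform_neq0 p i q j : ell q j = ell p i -> p != q -> ev (pt p) (hform q j) != 0.
Proof.
move=> /esym/same_line[t [_ [_ pE _]]] pq; rewrite pE ev_hform_line eqxx mulr1.
by apply: contraNneq pq => t0; apply/eqP/pt_inj; rewrite pE t0 scale0r addr0.
Qed.

Lemma ev_hform_eq0 p i q j k : ell q j = ell p i -> k != i -> ev (pt q) (hform p k) = 0.
Proof.
move=> /same_line[t [_ [_ qE _]]] ki.
by rewrite qE ev_hform_line eq_sym (negPf ki) mulr0.
Qed.

Lemma hform_assoc_inj p i k : assoc (hform p i) (hform p k) -> i = k.
Proof.
move=> /(assoc_ev (pt p + 1 *: v p i)); rewrite !ev_hform_line eqxx mul1r oner_eq0 mul1r.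
by have [->|ik] := eqVneq i k; rewrite ?eqxx // (negPf ik) mulr0n eqxx.
Qed.

Lemma hform_assoc_same_line x y : ell y.1 y.2 = ell x.1 x.2 ->
  assoc (hform x.1 x.2) (hform y.1 y.2) -> x = y.
Proof.
case: x y => [q j] [r k] /= rq /(assoc_ev (pt q)); rewrite ev_hform eqxx.
have [qr|qr] := eqVneq q r; last by rewrite (negPf (ev_hform_neq0 rq qr)).
by move: rq; rewrite -qr => /ell_inj ->.
Qed.

Section Lagrange.
Variable lag : P -> {mpoly F[d]}.
Hypothesis lag_size : forall p, (msize (lag p) <= n.+1)%N.
Hypothesis lagE : forall p q, ev (pt q) (lag p) = (q == p)%:R.

Lemma lag_neq0 p : lag p != 0.
Proof.
apply: contra_neq (oner_neq0 F) => l0.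
have <- : ev (pt p) (lag p) = 1 by rewrite lagE eqxx.
by rewrite l0 raddf0.
Qed.

Lemma restrict_lag p r k : (forall i, ell p i != ell r k) ->
  restrict (pt r) (v r k) (lag p) = 0.
Proof.
move=> pr; apply: (@line_poly_eq0 r k _ [set q | incident ell r k q]) => [q|q t|].
- by rewrite inE.
- rewrite inE => /existsP[j /eqP qr] qE; rewrite /root horner_restrict -qE lagE.
  have [qp|_] := eqVneq q p; last by rewrite eqxx.
  by move: (pr j); rewrite -qp qr eqxx.
- by rewrite cardsE card_incident; apply: leq_trans (size_restrict _ _ _) (lag_size p).
Qed.

(** Of degree at most [n + 1], it vanishes at all joints and on every line except [ell p i]. *)
Definition gpoly p i := hform p i * lag p.

Lemma ev_gpoly p i r : ev (pt r) (gpoly p i) = 0.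
Proof.
rewrite rmorphM /= lagE; case: eqVneq => [->|_]; last by rewrite mulr0.
by rewrite ev_hform mul0r.
Qed.

Lemma msize_gpoly p i : (msize (gpoly p i) <= n.+2)%N.
Proof.
rewrite msizeM ?hform_neq0 ?lag_neq0 //.
have := leq_add (msize_aff (normal p i) (pt p)) (lag_size p).
by rewrite -subn1 leq_subLR.
Qed.

Lemma restrict_gpoly_neq0 p i q j : ell q j = ell p i ->
  restrict (pt p) (v p i) (gpoly q j) != 0.
Proof.
move=> qp; apply/eqP => /(restrict_same_line qp)/eqP; apply/negP.
rewrite rmorphM mulf_neq0 //= ?restrict_hform ?eqxx ?scale1r ?polyX_eq0 //.
apply: contra_neq (oner_neq0 F) => l0.
have := horner_restrict (pt q) (v q j) (lag q) 0.
by rewrite scale0r addr0 lagE eqxx l0 horner0.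
Qed.

Lemma restrict_gpoly p i r k : ell r k != ell p i ->
  restrict (pt r) (v r k) (gpoly p i) = 0.
Proof.
move=> rp; rewrite rmorphM /=.
have [/existsP[j /eqP pj]|] := boolP [exists j, ell p j == ell r k].
  rewrite (@restrict_same_line p j) ?mul0r // restrict_hform.
  by case: eqVneq => [ji|_]; [case/negP: rp; rewrite -pj ji|rewrite scale0r].
rewrite negb_exists => /forallP pr; rewrite restrict_lag ?mulr0 //.
Qed.

Lemma gpoly_eq0_line p i f : (msize f <= n.+2)%N -> (forall r, ev (pt r) f = 0) ->
  (restrict (pt p) (v p i) f)`_n.+1 = 0 -> restrict (pt p) (v p i) f = 0.
Proof.
move=> fn f0 c0; apply: (@line_poly_eq0 p i _ [set q | incident ell p i q]) => [q|q t|].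
- by rewrite inE.
- by move=> _ qE; rewrite /root horner_restrict -qE f0.
rewrite cardsE card_incident; apply/leq_sizeP => j; rewrite leq_eqVlt => /orP[/eqP <- //|nj].
by apply/leq_sizeP: j nj; exact: leq_trans (size_restrict _ _ _) fn.
Qed.

(* Both sides have degree at most [n.+1] and vanish on every other line, while on
   the common line they vanish at the same [n.+1] points. *)
Lemma gpoly_assoc p i q j : ell q j = ell p i -> assoc (gpoly q j) (gpoly p i).
Proof.
move=> qp; pose co f := (restrict (pt p) (v p i) f)`_n.+1.
have co_neq0 r k : ell r k = ell p i -> co (gpoly r k) != 0.
  move=> /restrict_gpoly_neq0; apply: contra_neq => c0.
  by apply: gpoly_eq0_line c0; [exact: msize_gpoly|exact: ev_gpoly].
exists (co (gpoly p i) / co (gpoly q j)); first by rewrite mulf_neq0 ?invr_eq0 ?co_neq0.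
set c := (_ / _); apply/eqP; rewrite -subr_eq0; apply/eqP.
have Dn : (msize (gpoly p i - c *: gpoly q j) <= n.+2)%N.
  apply: leq_trans (msizeD_le _ _) _; rewrite geq_max msize_gpoly msizeN.
  exact: leq_trans (msizeZ_le _ _) (msize_gpoly _ _).
have D0 : restrict (pt p) (v p i) (gpoly p i - c *: gpoly q j) = 0.
  apply: gpoly_eq0_line Dn _ _ => [r|].
    by rewrite rmorphB /= evZ !ev_gpoly mulr0 subrr.
  rewrite rmorphB /= restrictZ coefB coefZ -/(co (gpoly p i)) -/(co (gpoly q j)).
  by rewrite /c divfK ?subrr ?co_neq0.
apply: eq0_of_lines Dn _ => r k; have [rp|rp] := eqVneq (ell r k) (ell p i).
  exact: restrict_same_line D0.
by rewrite rmorphB /= restrictZ !restrict_gpoly ?qp // scaler0 subrr.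
Qed.

(** The prime form [hform q j] divides [hform p i * lag p] by [gpoly_assoc], but not [hform p i],
    which vanishes at [p] while [hform q j] does not. *)
Lemma hform_dvd_lag p i q j : ell q j = ell p i -> p != q -> mdvd (hform q j) (lag p).
Proof.
move=> qp pq; have [c c0 gE] := gpoly_assoc qp.
have : mdvd (hform q j) (hform p i * lag p).
  by exists (c *: lag q); rewrite -scalerAr -/(gpoly p i) gE.
move=> /(aff_prime (normal_neq0 q j))[|//].
move=> /(mdvd_aff_assoc (normal_neq0 q j) (normal_neq0 p i))/(assoc_ev (pt p)).
by rewrite (negPf (ev_hform_neq0 qp pq)) -/(hform p i) ev_hform eqxx.
Qed.

Definition other_flags p i : {set P * 'I_d} :=
  [set e | (ell e.1 e.2 == ell p i) && (e.1 != p)].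

Lemma card_other_flags p i : #|other_flags p i| = n.
Proof.
have := mult (ell p i); rewrite /multiplicity (cardsD1 (p, i)) inE eqxx add1n => -[<-].
apply: eq_card => -[q j]; rewrite !inE xpair_eqE negb_and andbC /=.
have [qp|] := eqVneq (ell q j) (ell p i); last by rewrite !andbF.
rewrite !andbT; case: (eqVneq q p) => //= q_p.
by move: qp; rewrite q_p => /ell_inj ->; rewrite eqxx.
Qed.

(** These [n] pairwise non-associate primes divide [lag p], which has degree at most [n]. *)
Lemma lag_prod p i : exists2 c, c != 0 &
  lag p = c *: \prod_(e in other_flags p i) hform e.1 e.2.
Proof.
have [|||g lE] := @prod_aff_mdvd F d _ (other_flags p i) (fun e => normal e.1 e.2)
  (fun e => pt e.1) (lag p).
- by move=> e; exact: normal_neq0.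
- move=> x y; rewrite !inE => /andP[/eqP xp _] /andP[/eqP yp _].
  by apply: hform_assoc_same_line; rewrite xp yp.
- move=> [q j]; rewrite inE => /andP[/eqP qp pq].
  by apply: hform_dvd_lag qp _; rewrite eq_sym.
have prod0 : \prod_(e in other_flags p i) hform e.1 e.2 != 0.
  by apply/prodf_neq0 => e _; exact: hform_neq0.
have g0 : g != 0 by apply: contraTneq (lag_neq0 p) => g0; rewrite lE g0 mulr0 eqxx.
have szP : msize (\prod_(e in other_flags p i) hform e.1 e.2) = n.+1.
  by rewrite msize_prod_aff ?card_other_flags // => e; exact: normal_neq0.
have := lag_size p; rewrite lE msizeM // szP addSn /= -[leqRHS]addn1 leq_add2l => g1.
have gC := msize1_polyC g1; exists g@_0.
  by apply: contraNneq g0 => g00; rewrite gC g00 mpolyC0.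
by rewrite {1}gC mulrC mul_mpolyC.
Qed.

(** Every other form in [lag_prod] meets the line only at its own joint, so the cofactor does not
    vanish at [q]. *)
Lemma lag_factor p i q j : ell q j = ell p i -> p != q ->
  exists g, lag p = hform q j * g /\ ev (pt q) g != 0.
Proof.
move=> qp pq; have [c c0 lE] := lag_prod p i.
have qjE : (q, j) \in other_flags p i by rewrite inE qp eqxx eq_sym.
exists (c *: \prod_(e in other_flags p i | e != (q, j)) hform e.1 e.2); split.
  by rewrite lE (bigD1 (q, j)) //= scalerAr.
rewrite evZ mulf_neq0 // rmorph_prod; apply/prodf_neq0 => -[r k] /=.
rewrite inE xpair_eqE /= => /andP[/andP[/eqP rp _] rk].
apply: (@ev_hform_neq0 q j); first by rewrite rp qp.
by apply: contraNneq rk => qr; move: rp; rewrite -qr -qp => /ell_inj ->; rewrite !eqxx.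
Qed.

(* The hyperplanes at [p] and at [q] containing the line through [p] and [q] agree:
   [hform q j] is also a factor of [lag p] along the line [ell p k], which gives a
   joint [r] on that line such that [lag r] is [hform p k] times a polynomial not
   vanishing at [q]; and [lag r] vanishes on all lines through [q] but one. *)
Lemma hform_transfer p i q j k : ell q j = ell p i -> p != q -> k != i ->
  exists k', assoc (hform p k) (hform q k').
Proof.
move=> qp pq ki; have [g [lE gq]] := lag_factor qp pq.
have [c c0 lP] := lag_prod p k.
have : mdvd (hform q j) (c *: \prod_(e in other_flags p k) hform e.1 e.2).
  by rewrite -lP; exact: hform_dvd_lag qp pq.
move=> /(mdvd_prod_aff (normal_neq0 q j) (fun e => normal_neq0 e.1 e.2) c0).
move=> [[r k1]]; rewrite inE /= => /andP[/eqP rp _] [c1 c10]; rewrite -!/(hform _ _) => hE.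
have [c2 c20] := gpoly_assoc rp; rewrite /gpoly lE hE => gE.
(* Up to a scalar [hform q j] is the form [hform r k1], and it cancels in [gpoly_assoc] for [p] and
   [r]. *)
have {gE} rE : hform p k * g = (c2 * c1) *: lag r.
  apply: (mulfI (hform_neq0 q j)).
  by rewrite mulrCA gE -!scalerAl -scalerAr scalerA.
have rq : r != q.
  apply: contraTneq isT => rq; have qk : ell p k = ell q k1 by rewrite -rp rq.
  have /negP := ev_hform_neq0 qk (introN eqP (fun e => negP pq (introT eqP (esym e)))).
  by rewrite (ev_hform_eq0 qp ki) eqxx.
(* The slope of [hform p k] along the [k2]-th line at [q]. Where it is nonzero, neither [hform p k]
   nor [g] vanishes on the line, hence neither does [lag r], and the line is one of those at [r]. *)
pose s k2 := (v q k2 *m normal p k) 0 0.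
have s_line k2 : s k2 != 0 -> exists i2, ell r i2 = ell q k2.
  move=> sk; have [/existsP[i2 /eqP]|] := boolP [exists i2, ell r i2 == ell q k2].
    by exists i2.
  rewrite negb_exists => /forallP /restrict_lag rl.
  have := congr1 (restrict (pt q) (v q k2)) rE.
  rewrite restrictZ rl scaler0 rmorphM /= => /eqP; rewrite mulf_eq0 => /orP[|/eqP g0].
    rewrite restrict_aff => /eqP/(congr1 (fun u : {poly F} => u`_1)).
    by rewrite coefD coefC coefZ coefX mulr1 add0r coef0 => sk0; case/eqP: sk.
  have := horner_restrict (pt q) (v q k2) g 0; rewrite g0 horner0 scale0r addr0.
  by move=> gq0; move: gq; rewrite -gq0 eqxx.
have [k' sk'] : exists k', s k' != 0.
  apply/existsP; apply: contraT; rewrite negb_exists => /forallP s0.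
  case/eqP: (normal_neq0 p k); rewrite -[LHS](mulKmx (A_unit q)).
  suff -> : A q *m normal p k = 0 by rewrite mulmx0.
  apply/colP => k2; rewrite [RHS]mxE; have := s0 k2; rewrite negbK => /eqP <-.
  by rewrite /s /v -row_mul [RHS]mxE.
(* Two lines through [q] cannot both contain [r != q]; with a single nonzero slope the normals are
   proportional. *)
have s0 k2 : k2 != k' -> s k2 = 0.
  move=> kk; apply/eqP; apply: contraT => /s_line[i2 rk2]; have [i1 rk'] := s_line _ sk'.
  have := ev_hform_neq0 (esym rk') rq.
  by rewrite (ev_hform_eq0 rk2) ?eqxx // eq_sym.
have nE : normal p k = s k' *: normal q k'.
  rewrite -[LHS](mulKmx (A_unit q)) [normal q k']colE scalemxAr; congr (_ *m _).
  apply/colP => k2; have -> : (A q *m normal p k) k2 0 = s k2.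
    by rewrite /s /v -row_mul [RHS]mxE.
  rewrite !mxE eqxx andbT.
  by case: eqVneq => [->|/s0 ->]; rewrite ?mulr1 ?mulr0.
exists k'; apply: assoc_sym; exists (s k') => //.
rewrite /hform -aff_scale -nE; apply: aff_base.
by have := ev_hform_eq0 qp ki; rewrite ev_aff.
Qed.

Variables (I : finType) (ha : I -> 'cV[F]_d) (hq : I -> 'rV[F]_d).
Hypothesis ha_neq0 : forall t, ha t != 0.
Let hs t := aff (ha t) (hq t).
Hypothesis hs_inj : forall t u, assoc (hs t) (hs u) -> t = u.

(** The invariant of the exchange. As [lag p] is nonzero at [p], it makes [S] exactly the set of
    forms [hs] vanishing at [p]. *)
Definition attained (S : {set I}) p :=
  (forall t, t \in S -> exists i, assoc (hs t) (hform p i)) /\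
  exists2 c, c != 0 & lag p = c *: \prod_(t in ~: S) hs t.

(** The form of [u] divides [lag p], so on the line of [t] at [p] it belongs to a joint [q]. The
    other forms of [S] pass to [q] by [hform_transfer], and [gpoly_assoc] exchanges [t] and [u] in
    the product. *)
Lemma attained_exchange S p t u : attained S p -> t \in S -> u \notin S ->
  exists q, attained (u |: (S :\ t)) q.
Proof.
move=> [Sp [c c0 lE]] tS uS; have [i ti] := Sp t tS.
have uC : u \in ~: S by rewrite inE.
have dvd_u : mdvd (hs u) (lag p).
  by exists (c *: \prod_(x in ~: S | x != u) hs x); rewrite lE (bigD1 u) //= scalerAr.
have [c1 c10 lP] := lag_prod p i; rewrite lP in dvd_u.
have [[q j]] := mdvd_prod_aff (ha_neq0 u) (fun e => normal_neq0 e.1 e.2) c10 dvd_u.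
rewrite inE /= -/(hs u) -/(hform q j) => /andP[/eqP qp q_p] uq.
have pq : p != q by rewrite eq_sym.
exists q; split.
  move=> x; rewrite !inE => /orP[/eqP ->|/andP[xt xS]]; first by exists j.
  have [k xk] := Sp x xS.
  have ki : k != i.
    apply: contraNneq xt => ki; apply/eqP/hs_inj; apply: assoc_trans xk _.
    by rewrite ki; exact: assoc_sym.
  have [k' kk'] := hform_transfer qp pq ki.
  by exists k'; exact: assoc_trans xk kk'.
have [b b0 gE] := gpoly_assoc qp; have [a a0 hE] := uq; have [e e0 fE] := ti.
have SC : ~: (u |: (S :\ t)) = t |: (~: S :\ u).
  have tu : (t == u) = false by apply: contraNF uS => /eqP <-.
  apply/setP => x; rewrite !inE; have [->|xt] := eqVneq x t; first by rewrite tu.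
  by rewrite /= negb_or.
exists ((b * a)^-1 * (e * c)); first by rewrite !mulf_neq0 ?invr_neq0 ?mulf_neq0.
rewrite SC big_setU1 /=; last by rewrite !inE tS andbF.
apply: (mulfI (aff_neq0 (hq u) (ha_neq0 u))); rewrite -/(hs u).
have lE' : lag p = c *: (hs u * \prod_(x in ~: S :\ u) hs x).
  by rewrite lE (big_setD1 u).
move: gE; rewrite /gpoly lE' hE fE => gE.
have ba0 : b * a != 0 by rewrite mulf_neq0.
have {}gE : (e * c) *: (hs t * (hs u * \prod_(x in ~: S :\ u) hs x))
    = (b * a) *: (hs u * lag q).
  by move: gE; rewrite -!scalerAl -!scalerAr !scalerA.
by rewrite -scalerAr [hs u * (hs t * _)]mulrCA -scalerA gE scalerA mulVf // scale1r.
Qed.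

Lemma attained_card (S0 S : {set I}) p0 : attained S0 p0 -> #|S| = #|S0| -> exists p, attained S p.
Proof.
move=> + cS; have [m] := ubnP #|S :\: S0|; elim: m S0 p0 cS => // m IH S0 p0 cS lt att.
have [/eqP|] := eqVneq (S :\: S0) finset.set0.
  rewrite finset.setD_eq0 => sub; exists p0; suff -> : S = S0 by [].
  by apply/eqP; rewrite eqEcard sub cS /=.
move=> /set0Pn[u]; rewrite inE => /andP[uS0 uS].
have [t] : exists t, t \in S0 :\: S.
  apply/set0Pn; rewrite -card_gt0 cardsD -cS finset.setIC -cardsD card_gt0.
  by apply/set0Pn; exists u; rewrite inE uS0.
rewrite inE => /andP[tS tS0]; have [q attq] := attained_exchange att tS0 uS0.
apply: IH attq.
  by rewrite cardsU1 !inE (negPf uS0) andbF cS (cardsD1 t S0) tS0.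
rewrite -ltnS; apply: leq_trans lt; rewrite ltnS; apply: proper_card; apply/properP; split.
  apply/fintype.subsetP => x; rewrite !inE negb_or negb_and negbK.
  move=> /andP[/andP[xu /orP[/eqP ->|->]]] //; by rewrite (negPf tS).
by exists u; rewrite !inE ?uS ?uS0 // eqxx.
Qed.

End Lagrange.
End LagrangePolynomials.

(** * The hyperplanes and their intersections *)

Local Open Scope classical_set_scope.
Local Open Scope ring_scope.

Lemma in_inter (F : fieldType) d m (H : 'I_m -> set 'rV[F]_d) (S : {set 'I_m}) x :
  inter H S x <-> forall t, t \in S -> H t x.
Proof. by []. Qed.

Section Hyperplanes.
Variables (F : fieldType) (d n : nat) (P Lt : finType).
Variables (pt : P -> 'rV[F]_d) (A : P -> 'M[F]_d) (ell : P -> 'I_d -> Lt).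
Variable lset : Lt -> set 'rV[F]_d.
Hypotheses (d0 : (0 < d)%N) (pt_inj : injective pt).
Hypothesis A_unit : forall p, A p \in unitmx.
Hypothesis ell_inj : forall p, injective (ell p).
Hypothesis same_line : forall p i q j, ell q j = ell p i ->
  exists t c, [/\ c != 0, pt q = pt p + t *: row i (A p) & row j (A q) = c *: row i (A p)].
Hypothesis mult : forall l, multiplicity ell l = n.+1.
Hypothesis cardP : #|P| = 'C(n + d, d).
Hypothesis lsetE : forall p i, lset (ell p i) = line (pt p) (row i (A p)).
Local Notation hform := (hform pt A).
Local Notation normal := (normal A).

Lemma coord_hform p i x : ((x - pt p) *m invmx (A p)) 0 i = ev x (hform p i).
Proof. by rewrite ev_aff /normal colE mulmxA -colE [RHS]mxE. Qed.

Lemma point_of_hforms p x : (forall i, ev x (hform p i) = 0) -> x = pt p.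
Proof.
move=> x0; apply/eqP; rewrite -subr_eq0 -[_ - _](mulmxKV (A_unit p)).
suff -> : (x - pt p) *m invmx (A p) = 0 by rewrite mul0mx.
by apply/rowP => i; rewrite coord_hform x0 mxE.
Qed.

Lemma line_of_hforms p i x :
  line (pt p) (row i (A p)) x <-> forall k, k != i -> ev x (hform p k) = 0.
Proof.
split=> [[t _ <-] k ki|x0].
  by rewrite (ev_hform_line pt A_unit) eq_sym (negPf ki) mulr0.
exists (ev x (hform p i)) => //.
suff -> : ev x (hform p i) *: row i (A p) = x - pt p by rewrite addrC subrK.
rewrite -[RHS](mulmxKV (A_unit p)) rowE scalemxAl; congr (_ *m _).
apply/rowP => k; rewrite coord_hform !mxE eqxx /=.
by have [->|/x0 ->] := eqVneq k i; rewrite ?mulr1 ?mulr0.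
Qed.

(** The hyperplanes come from the [d] forms at one joint [p0] and the [n] factors of [lag p0] along
    one line. All [d]-subsets are attained by [attained_card]. *)
Lemma exists_hyperplanes : exists m (H : 'I_m -> set 'rV[F]_d), m = (d + n)%N /\
  [/\ injective H, forall i, is_hyperplane (H i), general_position H,
      forall q, (exists p, pt p = q) <-> wise_inter H d [set q]
    & forall l, (exists e, lset e = l) <-> wise_inter H d.-1 l].
Proof.
have /choice[lag lagP] := exists_lagrange d0 pt_inj A_unit ell_inj same_line mult cardP.
have lag_size p := (lagP p).1; have lagE p q := (lagP p).2 q.
have [p0 _] : exists p : P, p \in P by apply/card_gt0P; rewrite cardP bin_gt0 leq_addl.
pose i0 := Ordinal d0; pose E := other_flags ell p0 i0.
pose I : finType := ('I_d + {e : P * 'I_d | e \in E})%type.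
pose g (x : I) : P * 'I_d := match x with inl i => (p0, i) | inr e => val e end.
pose m := #|I|; have mE : m = (d + n)%N.
  by rewrite /m card_sum card_ord card_sig (card_other_flags ell_inj mult).
pose e (t : 'I_m) := g (enum_val t).
pose hs t := hform (e t).1 (e t).2.
have hs_inj t u : assoc (hs t) (hs u) -> t = u.
  rewrite /hs /e => tu; apply/enum_val_inj; move: tu.
  have Eline y z : y \in E -> z \in E -> ell z.1 z.2 = ell y.1 y.2.
    by rewrite !inE => /andP[/eqP -> _] /andP[/eqP -> _].
  have EP y : y \in E -> ell y.1 y.2 = ell p0 i0 /\ p0 != y.1.
    by rewrite !inE eq_sym => /andP[/eqP -> ]; rewrite eq_sym.
  case: (enum_val t) (enum_val u) => [i|[y yE]] [k|[z zE]] /=.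
  - by move=> /(hform_assoc_inj A_unit) ->.
  - have [zl zp] := EP z zE; move=> /(assoc_ev (pt p0)).
    by rewrite (negPf (ev_hform_neq0 pt_inj A_unit same_line zl zp)) ev_hform eqxx.
  - have [yl yp] := EP y yE; move=> /(assoc_ev (pt p0)).
    by rewrite (negPf (ev_hform_neq0 pt_inj A_unit same_line yl yp)) ev_hform eqxx.
  move=> /(hform_assoc_same_line pt_inj A_unit ell_inj same_line (Eline _ _ yE zE)) yz.
  by congr inr; apply: val_inj; rewrite /= yz.
pose att := attained pt A lag (fun t => normal (e t).1 (e t).2) (fun t => pt (e t).1).
pose S0 : {set 'I_m} := [set t | if enum_val t is inl _ then true else false]%SET.
have reindex_m (R : Type) (idx : R) (op : Monoid.com_law idx) (C : pred I) (G : I -> R) :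
    \big[op/idx]_(t : 'I_m | C (enum_val t)) G (enum_val t) = \big[op/idx]_(x | C x) G x.
  by rewrite [RHS](reindex (@enum_val I predT)) //; apply: onW_bij; exact: enum_val_bij.
have cS0 : #|S0| = d.
  rewrite -sum1_card (eq_bigl (fun t => if enum_val t is inl _ then true else false)).
    rewrite (reindex_m _ _ _ (fun x : I => if x is inl _ then true else false) (fun=> 1%N)).
    by rewrite big_sumType /= [X in (_ + X)%N]big_pred0 // addn0 sum_nat_const card_ord muln1.
  by move=> t; rewrite inE.
have att0 : att S0 p0.
  split=> [t|].
    rewrite inE /e /g; case: (enum_val t) => // i _; exists i; exists 1; rewrite ?oner_neq0 //.
    by rewrite scale1r.
  have [c c0 lE] := lag_prod d0 pt_inj A_unit ell_inj same_line mult cardP lag_size lagE p0 i0.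
  exists c => //; rewrite lE; congr (_ *: _).
  rewrite (eq_bigl (fun t => if enum_val t is inl _ then false else true)); last first.
    by move=> t; rewrite !inE; case: (enum_val t).
  rewrite (reindex_m _ _ _ (fun x : I => if x is inl _ then false else true)
    (fun x => aff (normal (g x).1 (g x).2) (pt (g x).1))).
  by rewrite big_sumType /= [X in X * _]big_pred0 // mul1r [LHS]big_sub.
have attS (S : {set 'I_m}) : #|S| = d -> exists p, att S p.
  move=> cS; apply: (attained_card d0 pt_inj A_unit ell_inj same_line mult cardP lag_size lagE
    _ hs_inj att0); [by move=> t; exact: normal_neq0|by rewrite cS cS0].
pose H t : set 'rV[F]_d := [set x | ev x (hs t) = 0].
(* A form outside [S] divides [lag p], whose value at [p] is 1. *)
have att_eq0 S p t : att S p -> (ev (pt p) (hs t) == 0) = (t \in S).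
  move=> [Sp [c c0 lE]]; have [tS|tS] := boolP (t \in S).
    by have [i /(assoc_ev (pt p))] := Sp t tS; rewrite -/(hs t) => ->; rewrite ev_hform eqxx.
  apply: contraTF isT => /eqP t0; have := lagE p p; rewrite lE eqxx (bigD1 t) ?inE //=.
  by rewrite evZ rmorphM /= t0 mul0r mulr0 => /esym/eqP; rewrite oner_eq0.
(* The [d] forms of [S] are pairwise non-associate, so they exhaust the [d] forms at [p]. *)
have att_form (S : {set 'I_m}) p i : #|S| = d -> att S p -> exists2 t, t \in S & assoc (hs t) (hform p i).
  move=> cS [Sp _]; have /choice[phi phiP] (t : 'I_m) :
      exists i, t \in S -> assoc (hs t) (hform p i).
    by have [/Sp[k]|_] := boolP (t \in S); [exists k|exists i].
  have phi_inj : {in S &, injective phi}.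
    move=> t u tS uS tu; apply: hs_inj; apply: assoc_trans (phiP t tS) _.
    by rewrite tu; exact/assoc_sym/phiP.
  have : i \in phi @: S.
    suff -> : phi @: S = [set: 'I_d]%SET by rewrite inE.
    by apply/eqP; rewrite eqEcard finset.subsetT cardsT card_ord card_in_imset // cS /=.
  by move=> /imsetP[t tS ->]; exists t => //; exact: phiP.
have att_inter (S : {set 'I_m}) p : #|S| = d -> att S p -> inter H S = [set pt p].
  move=> cS Sp; apply/seteqP; split=> [x /in_inter Sx|_ -> t tS].
    apply: point_of_hforms => i; have [t tS /(assoc_ev x) tx] := att_form S p i cS Sp.
    by apply/eqP; rewrite -tx; apply/eqP; exact: Sx.
  by apply/eqP; rewrite (att_eq0 _ _ _ Sp).
have att_line (S : {set 'I_m}) p i t : #|S| = d -> att S p -> t \in S -> assoc (hs t) (hform p i) ->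
    inter H (S :\ t) = lset (ell p i).
  move=> cS Sp tS ti; rewrite lsetE; apply/seteqP; split=> [x /in_inter Sx|x].
    apply/line_of_hforms => k ki; have [u uS uk] := att_form S p k cS Sp.
    apply/eqP; rewrite -(assoc_ev x uk); apply/eqP; apply: Sx; rewrite !inE uS andbT.
    apply: contraNneq ki => ut; apply/eqP; apply: (hform_assoc_inj A_unit (p := p)).
    by apply: assoc_trans (assoc_sym uk) _; rewrite ut.
  move=> /line_of_hforms xk; apply/in_inter => u; rewrite !inE => /andP[ut uS].
  have [k uk] := Sp.1 u uS; apply/eqP; rewrite (assoc_ev x uk) xk ?eqxx //.
  apply: contraNneq ut => ki; apply/eqP/hs_inj; apply: assoc_trans uk _.
  by rewrite ki; exact: assoc_sym.
have att_inj S T p : att S p -> att T p -> S = T.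
  by move=> Sp Tp; apply/setP => t; rewrite -(att_eq0 _ _ _ Sp) -(att_eq0 _ _ _ Tp).
(* An injection from the [d]-subsets to the joints, both [binom (n + d) d] in number, is onto. *)
have att_onto p : exists2 S : {set 'I_m}, #|S| = d & att S p.
  have /choice[psi psiP] (S : {set 'I_m}) : exists p, #|S| = d -> att S p.
    by have [/attS[q]|/eqP nS] := eqVneq #|S| d; [exists q|exists p0].
  pose D := [set S : {set 'I_m} | #|S| == d]%SET.
  have psi_inj : {in D &, injective psi}.
    move=> S T; rewrite !inE => /eqP/psiP Sp /eqP/psiP Tp ST.
    by apply: (att_inj S T (psi S)) => //; rewrite ST.
  have : p \in psi @: D.
    suff -> : psi @: D = [set: P]%SET by rewrite inE.
    apply/eqP; rewrite eqEcard finset.subsetT cardsT card_in_imset // card_draws card_ord.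
    by rewrite cardP mE addnC leqnn.
  by move=> /imsetP[S]; rewrite inE => /eqP cS ->; exists S => //; exact: psiP.
have through t : exists2 S : {set 'I_m}, #|S| = d & t \in S.
  have [tS0|tS0] := boolP (t \in S0); first by exists S0.
  have [s sS0] : exists s, s \in S0 by apply/set0Pn; rewrite -card_gt0 cS0.
  exists (t |: (S0 :\ s)); last by rewrite !inE eqxx.
  by rewrite cardsU1 in_setD1 (negPf tS0) andbF -cS0 (cardsD1 s S0) sS0.
exists m, H; split=> //; split.
(* If [H t = H u] with [t != u], both forms belong to one joint [p], and some line at [p] lies in
   the first hyperplane but not in the second. *)
- move=> t u tu; apply/eqP; apply: contraT => t_u.
  have [S cS tS] := through t; have [p Sp] := attS S cS.
  have uS : u \in S.
    rewrite -(att_eq0 _ _ _ Sp); apply/eqP; have : H t (pt p).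
      by apply/eqP; rewrite (att_eq0 _ _ _ Sp).
    by rewrite tu.
  have [i ti] := Sp.1 t tS; have [j uj] := Sp.1 u uS.
  have ij : j != i.
    apply: contraNneq t_u => ji; apply/eqP/hs_inj; apply: assoc_trans ti _.
    by rewrite -ji; exact: assoc_sym.
  have : H t (pt p + 1 *: row j (A p)).
    apply/eqP; rewrite (assoc_ev _ ti) (ev_hform_line pt A_unit) (negPf ij).
    by rewrite mulr0.
  rewrite tu => /eqP; rewrite (assoc_ev _ uj) (ev_hform_line pt A_unit) eqxx mulr1.
  by rewrite oner_eq0.
- move=> t; exists (normal (e t).1 (e t).2), ((pt (e t).1 *m normal (e t).1 (e t).2) 0 0).
  split; first exact: normal_neq0.
  apply/seteqP; split=> x; rewrite /H /hs /= ev_aff mulmxBl !mxE => /eqP.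
    by rewrite subr_eq0 => /eqP.
  by move=> /eqP ->; rewrite subrr.
- split=> [S cS|S T cS cT].
    by have [p Sp] := attS S cS; exists (pt p); exact: att_inter.
  have [[p Sp] [q Tq]] := (attS S cS, attS T cT).
  rewrite (att_inter _ _ cS Sp) (att_inter _ _ cT Tq) => pq.
  have : [set pt q] (pt p) by rewrite -pq.
  by move=> /pt_inj pqE; apply: (att_inj _ _ p) => //; rewrite pqE.
- move=> x; split=> [[p <-]|[S cS SE]].
    by have [S cS Sp] := att_onto p; exists S => //; exact: att_inter.
  have [p Sp] := attS S cS; exists p; move: SE; rewrite (att_inter _ _ cS Sp) => pE.
  have : [set x] (pt p) by rewrite -pE.
  by [].
move=> l; split=> [[l' <-]|[S cS <-]].
  have /card_gt0P[[p i]] : (0 < #|[set x : P * 'I_d | ell x.1 x.2 == l']%SET|)%N.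
    by rewrite -/(multiplicity ell l') mult.
  rewrite inE /= => /eqP <-; have [S cS Sp] := att_onto p.
  have [t tS ti] := att_form S p i cS Sp; exists (S :\ t); last exact: att_line.
  by rewrite /= -cS (cardsD1 t S) tS.
(* As [d <= m], a further hyperplane completes the [(d - 1)]-subset to a [d]-subset. *)
have [t tS] : exists t, t \in ~: S.
  have dm : (d <= m)%N by rewrite mE leq_addr.
  by apply/set0Pn; rewrite -card_gt0 cardsCs finset.setCK card_ord cS subn_gt0 prednK.
pose T := t |: S; have cT : #|T| = d.
  by move: tS; rewrite cardsU1 finset.in_setC => ->; rewrite cS add1n prednK.
have tT : t \in T by rewrite !inE eqxx.
have [p Tp] := attS T cT; have [i ti] := Tp.1 t tT.
exists (ell p i); rewrite -(att_line T p i t) //; congr (inter H _).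
rewrite /T setU1K //; by move: tS; rewrite inE.
Qed.

End Hyperplanes.

(** * From a joints configuration to chosen flags *)

Lemma line_direction (F : fieldType) d (p q v w : 'rV[F]_d) : w != 0 ->
    line q w = line p v -> exists t c, [/\ c != 0, q = p + t *: v & w = c *: v].
Proof.
move=> w0 qp; have [t _ tE] : line p v q by rewrite -qp; exists 0; rewrite ?scale0r ?addr0.
have [s _ sE] : line p v (q + w) by rewrite -qp; exists 1; rewrite ?scale1r.
have wE : w = (s - t) *: v.
  by rewrite scalerBl -[LHS](addKr q) -sE -{1}tE opprD addrACA addNr add0r addrC.
exists t, (s - t); split=> //; apply: contraNneq w0 => st0.
by rewrite wE st0 scale0r.
Qed.

Lemma line_through (F : fieldType) d (p q v : 'rV[F]_d) : line q v p -> line q v = line p v.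
Proof.
move=> [t _ <-]; apply/seteqP; split=> _ [s _ <-].
  by exists (s - t) => //; rewrite -addrA -scalerDl addrC [t + _]addrC subrK addrC.
by exists (t + s) => //; rewrite scalerDl addrA.
Qed.

Lemma unitmx_of_free (F : fieldType) d (v : 'I_d -> 'rV[F]_d) :
  free [tuple v i | i < d] -> (\matrix_i v i) \in unitmx.
Proof.
move=> /freeP fr; rewrite -row_free_unit -kermx_eq0; apply/rowV0P => u /sub_kermxP uA.
apply/rowP => i; rewrite mxE; apply: (fr (fun i => u 0 i)); rewrite -[RHS]uA mulmx_sum_row.
by apply: eq_bigr => j _; rewrite rowK -tnth_nth tnth_mktuple.
Qed.

Lemma rbinom_nat (R : realType) m k : (k <= m)%N -> rbinom (m%:R : R) k = 'C(m, k)%:R.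
Proof.
move=> km; rewrite /rbinom -[RHS](mulfK (x := k`!%:R)) ?pnatr_eq0 -?lt0n ?fact_gt0 //.
congr (_ / _); rewrite -natrM bin_ffact ffact_prod natr_prod.
by apply: eq_bigr => i _; rewrite natrB // ltnW // (leq_trans (ltn_ord i)).
Qed.

Theorem theorem1p3 (F : fieldType) (R : realType) (d : nat) (hd : (0 < d)%N)
  (J : {fset 'rV[F]_d}) (L : {fset set 'rV[F]_d})
  (hJL : joints_configuration J L)
  (M : R) (hM : d%:R <= M)
  (hJ : (#|` J|)%:R = rbinom M d) (hL : (#|` L|)%:R = rbinom M d.-1) :
  exists m : nat, M = m%:R /\
    exists H : 'I_m -> set 'rV[F]_d,
      [/\ injective H,
          forall i, is_hyperplane (H i),
          general_position H,
          [set p | p \in J] = [set p | wise_inter H d [set p]]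
        & [set l | l \in L] = wise_inter H d.-1].
Proof.
have [_ joint] := hJL; pose P : finType := J; pose Lt : finType := L.
have /choice[lv lvP] (p : P) : exists lv : ('I_d -> set 'rV[F]_d) * ('I_d -> 'rV[F]_d),
    [/\ forall i, lv.1 i \in L /\ lv.1 i (val p), forall i, is_direction (lv.1 i) (lv.2 i)
      & free [tuple lv.2 i | i < d]].
  by have [l [v H]] := joint _ (valP p); exists (l, v).
pose pt (p : P) : 'rV[F]_d := val p; pose A (p : P) := \matrix_i (lv p).2 i.
have lL p i : (lv p).1 i \in L by have [/(_ i)[]] := lvP p.
pose ell p i : Lt := [` lL p i]%fset; pose lset (l : Lt) : set 'rV[F]_d := val l.
have A_unit p : A p \in unitmx by have [_ _ /unitmx_of_free] := lvP p.
have rowA p i : row i (A p) = (lv p).2 i by rewrite rowK.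
have lsetE p i : lset (ell p i) = line (pt p) (row i (A p)).
  have [/(_ i)[_ pl] /(_ i)[_ [q qE]] _] := lvP p; rewrite rowA /lset /= qE.
  by apply: line_through; rewrite -qE.
have row0 p i : row i (A p) != 0 by rewrite rowA; have [_ /(_ i)[]] := lvP p.
have same_line p i q j : ell q j = ell p i -> exists t c,
    [/\ c != 0, pt q = pt p + t *: row i (A p) & row j (A q) = c *: row i (A p)].
  by move=> qp; apply: line_direction => //; rewrite -!lsetE qp.
have ell_inj p : injective (ell p).
  move=> i j /same_line[t [c [_ _ ij]]]; apply/eqP; apply: contraT => i_j.
  have := dual_normal A_unit p i i; rewrite ij -scalemxAl [LHS]mxE dual_normal //.
  by rewrite eq_sym (negPf i_j) eqxx mulr0 => /eqP; rewrite eq_sym oner_eq0.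
have pt_inj : injective pt by exact: val_inj.
have cP : #|P|%:R = rbinom M d by rewrite -hJ cardfE.
have cL : #|Lt|%:R = rbinom M d.-1 by rewrite -hL cardfE.
have P0 : (0 < #|P|)%N.
  rewrite -(ltr0n R) cP /rbinom divr_gt0 ?ltr0n ?fact_gt0 //.
  apply: prodr_gt0 => i _; rewrite subr_gt0; apply: lt_le_trans hM.
  by rewrite ltr_nat.
have multE := multiplicity_eq ell_inj hd P0
  (fun N B al n nN B0 => card_low_set pt_inj A_unit (incP same_line) al nN B0) hM cP cL.
have [p0 _] : exists p : P, p \in P by exact/card_gt0P.
pose l0 := ell p0 (Ordinal hd).
have l0_gt0 : (0 < multiplicity ell l0)%N.
  by apply/card_gt0P; exists (p0, Ordinal hd); rewrite inE.
(* One multiplicity, a natural number equal to [M - d + 1], makes [M] an integer. *)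
pose n := (multiplicity ell l0).-1.
have nE : multiplicity ell l0 = n.+1 by rewrite prednK.
have ME : M = (n + d)%:R.
  by have := multE l0; rewrite nE natrD -natr1 => /(addIr _) ->; rewrite subrK.
have mult l : multiplicity ell l = n.+1.
  by apply/eqP; rewrite -nE -(eqr_nat R) !multE.
have cardP : #|P| = 'C(n + d, d).
  by apply/eqP; rewrite -(eqr_nat R) cP ME rbinom_nat // leq_addl.
have [m [H [mE [Hinj Hhyp Hgen HJ HL]]]] :=
  exists_hyperplanes hd pt_inj A_unit ell_inj same_line mult cardP lsetE.
exists m; split; first by rewrite ME mE addnC.
exists H; split=> //.
  apply/seteqP; split=> [p pJ|p /HJ[q <-]]; last exact: valP.
  by apply/HJ; exists [` pJ]%fset.
apply/seteqP; split=> [l lL'|l /HL[e <-]]; last exact: valP.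
by apply/HL; exists [` lL']%fset.
Qed.
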